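(* Let $k$ be a commutative ring. The bar construction, restricted to curved dg algebras, $B:\mathsf{Alg}_{[0,2]}\to\mathsf{CgaCdg}$, and the cobar construction $\Omega:\mathsf{CgaCdg}\to\mathsf{Alg}_{[0,2]}$ form a pair of adjoint functors, with $\Omega$ left adjoint to $B$.
   Context: $k$ is a commutative associative unital ring; graded means $\mathbf Z$-graded; $\otimes=\otimes_k$; Koszul sign rule. For a graded module $V$, $(SV)^p=V^{p+1}$; $s:V\to SV$ and $w:SV\to V$ are the canonical maps of degree $-1$ and $1$, and $w$ also denotes $V\to S^{-1}V$ of degree $1$. $\mathsf{Alg}_{[0,2]}$ is the category of curved dg algebras over $k$ (not necessarily unital): graded modules $A$ with an associative degree $0$ multiplication $m_2$, an element $c\in A^2$ (curvature, $m_0:k\to A$, $1\mapsto c$) and a degree $1$ map $d=m_1$ with $d(c)=0$, $d(d(a))=ca-ac$, $d(ab)=d(a)b+(-1)^{|a|}a\,d(b)$. Morphisms are degree $0$ maps preserving curvature and multiplication and commuting with $d$. $\mathsf{CgaCdg}$ is the category of cocomplete graded-augmented counital dg coalgebras: $(C,d,\Delta,\varepsilon,\eta)$ with $(C,d,\Delta,\eta)$ a counital dg coalgebra (counit $\eta:C\to k$) and $(C,\Delta,\varepsilon,\eta)$ an augmented graded coalgebra with augmentation $\varepsilon:k\to C$ (not required to satisfy $d\varepsilon=0$) whose reduced coalgebra $\overline C=\mathrm{cok}\,\varepsilon$ is the colimit of the kernels of the iterated comultiplications $\overline C\to\overline C^{\otimes n}$. Morphisms are coalgebra morphisms compatible with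 augmentations, counits and codifferentials. $\mathsf{Tw}(C,A)$ is the set of degree $1$ maps $\tau:C\to A$ with $\tau\varepsilon=0$ and $m_0\eta+(m_1\tau+\tau d_C)+m_2(\tau\otimes\tau)\Delta=0$. The bar construction $BA$ of a curved dg algebra $A$ is the object of $\mathsf{CgaCdg}$ representing $C\mapsto\mathsf{Tw}(C,A)$; concretely $BA=T^c(SA)=\bigoplus_{i\ge0}(SA)^{\otimes i}$ with the deconcatenation comultiplication, the canonical counit and augmentation, and the unique coderivation $d_{BA}$ whose composition with the projection to $k$ vanishes and whose composition with the projection to $SA$ has components $-s\,m_i\,w^{\otimes i}$, $i=0,1,2$. The cobar construction $\Omega C$ is the curved dg algebra corepresenting $A\mapsto\mathsf{Tw}(C,A)$; its underlying graded algebra is the reduced tensor algebra $\bigoplus_{i\ge1}(S^{-1}\overline C)^{\otimes i}$. Both are functorial through these (co)representability properties. *)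

(* Defs.v *)
From HB Require Import structures.
From mathcomp Require Import all_boot all_order all_algebra.
From mathcomp Require Import boolp classical_sets cardinality fsbigop.

Set Implicit Arguments.
Unset Strict Implicit.
Unset Printing Implicit Defensive.

Import GRing.Theory.
Local Open Scope ring_scope.
Local Open Scope quotient_scope.
Local Obligation Tactic := idtac.

Record category := Category {
  obj :> Type;
  hom : obj -> obj -> Type;
  idm : forall X, hom X X;
  cmp : forall X Y Z, hom Y Z -> hom X Y -> hom X Z;
  cmp_idl : forall X Y (f : hom X Y), cmp (idm Y) f = f;
  cmp_idr : forall X Y (f : hom X Y), cmp f (idm X) = f;
  cmpA : forall X Y Z T (h : hom Z T) (g : hom Y Z) (f : hom X Y),
    cmp h (cmp g f) = cmp (cmp h g) f }.
Arguments idm {c} X.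
Arguments cmp {c X Y Z} g f.

Record functor (C D : category) := Functor {
  fobj :> C -> D;
  fmap : forall X Y : C, hom X Y -> hom (fobj X) (fobj Y);
  fmap_id : forall X : C, fmap (idm X) = idm (fobj X);
  fmap_cmp : forall (X Y Z : C) (g : hom Y Z) (f : hom X Y),
    fmap (cmp g f) = cmp (fmap g) (fmap f) }.
Arguments fmap {C D} _ {X Y} _.

Definition left_adjoint (C D : category) (F : functor C D) (G : functor D C) :=
  exists Phi : forall (X : C) (Y : D), hom (F X) Y -> hom X (G Y),
    [/\ forall X Y, bijective (@Phi X Y),
        forall (X X' : C) (Y : D) (f : hom X' X) (u : hom (F X) Y),
          Phi X' Y (cmp u (fmap F f)) = cmp (Phi X Y u) f
      & forall (X : C) (Y Y' : D) (g : hom Y Y') (u : hom (F X) Y),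
          Phi X Y' (cmp g u) = cmp (fmap G g) (Phi X Y u)].

Section Linear.
Variable k : comPzRingType.

Definition mklin (U V : lmodType k) (f : U -> V) (fL : linear f) :
  {linear U -> V} := HB.pack f (GRing.isLinear.Build k U V *:%R f fL).

Lemma linear_ext (U V : lmodType k) (f g : {linear U -> V}) : f =1 g -> f = g.
Proof.
case: f g => f [[fA] [fZ]] [g [[gA] [gZ]]] /= /funext fg; subst g.
by congr (GRing.Linear.Pack (GRing.Linear.Class _ _)); congr (_ _);
  exact: Prop_irrelevance.
Qed.
End Linear.

(* [presented adm] is the universal k-module receiving a map [gen] from X that
   is admissible, where [adm] singles out the admissible maps from X to
   k-modules (e.g. the bilinear maps, for the tensor product).  Its elements are
   formal k-linear combinations of elements of X, two of which are identified
   when every admissible map gives them the same value. *)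
Section Presented.
Variables (k : comPzRingType) (X : choiceType).
Variable adm : forall M : lmodType k, (X -> M) -> Prop.

Definition feval (M : lmodType k) (f : X -> M) (s : seq (k * X)) : M :=
  \sum_(t <- s) t.1 *: f t.2.

Definition prel (s t : seq (k * X)) : bool :=
  `[< forall (M : lmodType k) (f : X -> M), adm f -> feval f s = feval f t >].

Fact prel_equiv : equiv_class_of prel.
Proof.
split=> [s|s t|t s u]; first by apply/asboolP.
  by apply/asboolP/asboolP => H M f af; rewrite (H M f af).
by move=> /asboolP H1 /asboolP H2; apply/asboolP => M f af; rewrite H1 ?H2.
Qed.
Canonical prel_equivrel := EquivRelPack prel_equiv.

Definition presented := {eq_quot prel}.
HB.instance Definition _ := Choice.on presented.
HB.instance Definition _ := EqQuotient.on presented.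

Lemma feval_repr (M : lmodType k) (f : X -> M) s : adm f ->
  feval f (repr (\pi_presented s)) = feval f s.
Proof.
move=> af; have /eqmodP/asboolP : repr (\pi_presented s) = s %[mod presented].
  by rewrite reprK.
exact.
Qed.

Lemma presentedP (x y : presented) :
  (forall (M : lmodType k) (f : X -> M), adm f ->
     feval f (repr x) = feval f (repr y)) -> x = y.
Proof. by move=> H; rewrite -[x]reprK -[y]reprK; apply/eqmodP/asboolP. Qed.

Definition scales (a : k) (s : seq (k * X)) := [seq (a * t.1, t.2) | t <- s].
Definition padd (x y : presented) : presented := \pi_presented (repr x ++ repr y).
Definition pscale (a : k) (x : presented) : presented := \pi_presented (scales a (repr x)).
Definition popp (x : presented) : presented := pscale (-1) x.
Definition pzero : presented := \pi_presented [::].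

Fact feval_scale (M : lmodType k) (f : X -> M) a s :
  feval f (scales a s) = a *: feval f s.
Proof.
rewrite /feval /scales big_map scaler_sumr.
by apply: eq_bigr => t _; rewrite scalerA.
Qed.
Fact feval_padd (M : lmodType k) (f : X -> M) x y : adm f ->
  feval f (repr (padd x y)) = feval f (repr x) + feval f (repr y).
Proof. by move=> af; rewrite feval_repr // /feval big_cat. Qed.
Fact feval_pscale (M : lmodType k) (f : X -> M) a x : adm f ->
  feval f (repr (pscale a x)) = a *: feval f (repr x).
Proof. by move=> af; rewrite feval_repr // feval_scale. Qed.
Fact feval_pzero (M : lmodType k) (f : X -> M) : adm f ->
  feval f (repr pzero) = 0.
Proof. by move=> af; rewrite feval_repr // /feval big_nil. Qed.

Fact paddA : associative padd.
Proof. by move=> x y z; apply: presentedP => M f af; rewrite !feval_padd ?addrA. Qed.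
Fact paddC : commutative padd.
Proof. by move=> x y; apply: presentedP => M f af; rewrite !feval_padd // addrC. Qed.
Fact padd0 : left_id pzero padd.
Proof. by move=> x; apply: presentedP => M f af; rewrite feval_padd // feval_pzero ?add0r. Qed.
Fact paddN : left_inverse pzero popp padd.
Proof.
move=> x; apply: presentedP => M f af.
by rewrite feval_padd // feval_pscale // feval_pzero // scaleN1r addNr.
Qed.
HB.instance Definition _ :=
  GRing.isZmodule.Build presented paddA paddC padd0 paddN.

Fact pscaleA a b x : pscale a (pscale b x) = pscale (a * b) x.
Proof. by apply: presentedP => M f af; rewrite !feval_pscale ?scalerA. Qed.
Fact pscale1 : left_id 1 pscale.
Proof. by move=> x; apply: presentedP => M f af; rewrite !feval_pscale ?scale1r. Qed.
Fact pscaleDr : right_distributive pscale +%R.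
Proof.
by move=> a x y; apply: presentedP => M f af; rewrite !(feval_padd,feval_pscale) // scalerDr.
Qed.
Fact pscaleDl x : {morph pscale^~ x : a b / a + b}.
Proof.
by move=> a b; apply: presentedP => M f af; rewrite !(feval_padd,feval_pscale) // scalerDl.
Qed.
HB.instance Definition _ :=
  GRing.Zmodule_isLmodule.Build k presented pscaleA pscale1 pscaleDr pscaleDl.

Definition gen (x : X) : presented := \pi_presented [:: (1, x)].

(* The linear map [presented -> M] induced by [f]; meaningful only if [adm f]. *)
Definition plift (M : lmodType k) (f : X -> M) (x : presented) : M :=
  feval f (repr x).

Lemma plift_gen (M : lmodType k) (f : X -> M) x : adm f -> plift f (gen x) = f x.
Proof. by move=> af; rewrite /plift feval_repr // /feval big_seq1 scale1r. Qed.

Lemma plift_linear (M : lmodType k) (f : X -> M) : adm f -> linear (plift f).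
Proof. by move=> af a x y; rewrite /plift feval_padd // feval_pscale. Qed.

Lemma presented_gen (x : presented) : x = \sum_(t <- repr x) t.1 *: gen t.2.
Proof.
apply: presentedP => M f af; rewrite -![feval f (repr _)]/(plift f _).
pose g := mklin (plift_linear af).
rewrite -[plift f (\sum_(t <- _) _)]/(g _) linear_sum /=.
rewrite {1}/plift /feval; apply: eq_bigr => t _.
by rewrite -[RHS]/(g _) linearZ /= plift_gen.
Qed.

Lemma presented_ext (M : lmodType k) (f g : {linear presented -> M}) :
  (forall x, f (gen x) = g (gen x)) -> f =1 g.
Proof.
move=> fg x; rewrite [x]presented_gen !linear_sum.
by apply: eq_bigr => t _; rewrite !linearZ fg.
Qed.

End Presented.
Arguments gen {k X adm} x.

Section Tensor.
Variable k : comPzRingType.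

Definition bilin (U V M : lmodType k) (f : U * V -> M) : Prop :=
  (forall y, linear (fun x => f (x, y))) /\ (forall x, linear (fun y => f (x, y))).

Definition tensor (U V : lmodType k) : lmodType k := presented (@bilin U V).

Definition tens (U V : lmodType k) (x : U) (y : V) : tensor U V := gen (x, y).

(* The linear map on U ⊗ V induced by a bilinear map. *)
Definition tlift (U V M : lmodType k) (f : U -> V -> M) : tensor U V -> M :=
  plift (fun z => f z.1 z.2).

(* f ⊗ g, without sign. *)
Definition tmap (U V U' V' : lmodType k) (f : U -> U') (g : V -> V') :
  tensor U V -> tensor U' V' := tlift (fun x y => tens (f x) (g y)).

Definition tassoc (U V W : lmodType k) :
  tensor (tensor U V) W -> tensor U (tensor V W) :=
  tlift (fun t z => tlift (fun x y => tens x (tens y z)) t).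

Lemma tens_bilin (U V : lmodType k) : bilin (fun z => tens z.1 z.2 : tensor U V).
Proof.
have H (M : lmodType k) (f : U * V -> M) (af : bilin f) z :
  feval f (repr (gen z : presented (@bilin U V))) = f z.
  exact: plift_gen.
split=> [y|x] a u v; apply: presentedP => M f af;
  rewrite -![feval f _]/(plift f _) plift_linear // !plift_gen //=;
  by case: af => af1 af2; rewrite ?af1 ?af2.
Qed.

Lemma bilinP (U V M : lmodType k) (f : U -> V -> M) :
  (forall y, linear (f^~ y)) -> (forall x, linear (f x)) ->
  bilin (fun z => f z.1 z.2).
Proof. by split. Qed.

Lemma tlift_tens (U V M : lmodType k) (f : U -> V -> M) x y :
  bilin (fun z => f z.1 z.2) -> tlift f (tens x y) = f x y.
Proof. exact: plift_gen. Qed.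

Lemma tmap_bilin (U V U' V' : lmodType k) (f : {linear U -> U'}) (g : {linear V -> V'}) :
  bilin (fun z => tens (f z.1) (g z.2)).
Proof.
case: (tens_bilin U' V') => H1 H2.
by split=> [y|x] a u v /=; rewrite linearP ?(H1 (g y)) ?(H2 (f x)).
Qed.

Lemma tmap_linear (U V U' V' : lmodType k) (f : {linear U -> U'}) (g : {linear V -> V'}) :
  linear (tmap f g).
Proof. exact/plift_linear/tmap_bilin. Qed.

Lemma tmap_tens (U V U' V' : lmodType k) (f : {linear U -> U'}) (g : {linear V -> V'}) x y :
  tmap f g (tens x y) = tens (f x) (g y).
Proof. exact/tlift_tens/tmap_bilin. Qed.

Lemma tensor_ext (U V M : lmodType k) (f g : {linear tensor U V -> M}) :
  (forall x y, f (tens x y) = g (tens x y)) -> f =1 g.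
Proof. by move=> fg; apply: presented_ext => -[x y]; apply: fg. Qed.

Lemma tmap_id (U V : lmodType k) (t : tensor U V) : tmap idfun idfun t = t.
Proof.
pose f := mklin (@tmap_linear U V U V idfun idfun).
have := @tensor_ext U V _ f idfun; apply=> x y.
exact: (@tmap_tens U V U V idfun idfun).
Qed.

Lemma tmap_comp (U V U' V' U'' V'' : lmodType k)
    (f : {linear U -> U'}) (g : {linear V -> V'})
    (f' : {linear U' -> U''}) (g' : {linear V' -> V''}) t :
  tmap (f' \o f) (g' \o g) t = tmap f' g' (tmap f g t).
Proof.
pose F := mklin (tmap_linear f g); pose F' := mklin (tmap_linear f' g').
pose G := mklin (tmap_linear (f' \o f) (g' \o g)).
have := @tensor_ext U V _ G (F' \o F); apply=> x y /=.
by rewrite (tmap_tens (f' \o f) (g' \o g)) !tmap_tens.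
Qed.

Lemma tassoc_tens (U V W : lmodType k) (x : U) (y : V) (z : W) :
  tassoc (tens (tens x y) z) = tens x (tens y z).
Proof.
have B1 (z' : W) : bilin (fun u : U * V => tens u.1 (tens u.2 z')).
  case: (tens_bilin U (tensor V W)) => H1 H2; case: (tens_bilin V W) => H3 H4.
  split=> [v|u] a p q /=; first exact: (H1 (tens v z')).
  by rewrite (H3 z' a p q) (H2 u).
rewrite /tassoc tlift_tens ?tlift_tens //; split=> [z'|t] a p q /=.
  exact: (plift_linear (B1 z')).
pose L z' := mklin (plift_linear (B1 z')).
rewrite -[LHS]/(L _ t) -[X in _ = _ *: X + _]/(L _ t) -[X in _ = _ + X]/(L _ t).
pose R := GRing.add_fun (a \*: L p) (L q).
have := @tensor_ext U V _ (L (a *: p + q)) R; apply=> u v.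
rewrite /R /= -![plift _ _]/(tlift (fun u v => tens u (tens v _)) _) !tlift_tens //.
case: (tens_bilin U (tensor V W)) => H1 H2; case: (tens_bilin V W) => H3 H4.
by rewrite (H4 v a p q) (H2 u).
Qed.

(* The cokernel of [e], that is, the universal module receiving a linear map
   from V that kills the image of [e]. *)
Definition coker_adm (U V : lmodType k) (e : U -> V) (M : lmodType k) (f : V -> M) :=
  linear f /\ forall u, f (e u) = 0.

Definition coker (U V : lmodType k) (e : U -> V) : lmodType k :=
  presented (coker_adm e).

Definition coker_pr (U V : lmodType k) (e : U -> V) (x : V) : coker e := gen x.

Lemma coker_pr_adm (U V : lmodType k) (e : U -> V) : coker_adm e (coker_pr e).
Proof.
split=> [a x y|u]; apply: presentedP => M f af; rewrite -![feval f _]/(plift f _).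
  by rewrite plift_linear // !plift_gen //; case: af => ->.
pose L := mklin (plift_linear af).
rewrite plift_gen // -[RHS]/(L 0) linear0; exact: af.2.
Qed.

(* [multilin f]: on words of each length n, f is an n-linear map.  The module
   generated by all words x_1 ... x_n in V and universal for this is therefore
   the direct sum over n >= 0 of the tensor powers of V, the word x_1 ... x_n
   standing for x_1 ⊗ ... ⊗ x_n. *)
Definition multilin (V M : lmodType k) (f : seq V -> M) : Prop :=
  forall u v : seq V, linear (fun x => f (u ++ x :: v)).

Definition tensor_alg (V : lmodType k) : lmodType k := presented (@multilin V).

Definition word (V : lmodType k) (u : seq V) : tensor_alg V := gen u.

Lemma word_multilin (V : lmodType k) : multilin (@word V).
Proof.
move=> u v a x y; apply: presentedP => M f af; rewrite -![feval f _]/(plift f _).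
by rewrite plift_linear // !plift_gen // af.
Qed.

(* The reduced version, without the summand n = 0 (spanned by the empty word). *)
Definition multilin_red (V M : lmodType k) (f : seq V -> M) : Prop :=
  multilin f /\ f [::] = 0.

Definition red_tensor_alg (V : lmodType k) : lmodType k :=
  presented (@multilin_red V).

Definition red_word (V : lmodType k) (u : seq V) : red_tensor_alg V := gen u.

Lemma red_word_multilin (V : lmodType k) : multilin_red (@red_word V).
Proof.
split=> [u v a x y|]; apply: presentedP => M f af; rewrite -![feval f _]/(plift f _).
  by rewrite plift_linear // !plift_gen //; case: af => ->.
pose L := mklin (plift_linear af).
rewrite plift_gen // -[RHS]/(L 0) linear0; exact: af.2.
Qed.

(* V ⊗ (V ⊗ (... ⊗ V)), with n + 1 factors. *)
Fixpoint tpow (V : lmodType k) (n : nat) : lmodType k :=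
  if n is n'.+1 then tensor V (tpow V n') else V.

End Tensor.

(* A graded k-module is represented by its total module, the direct sum of its
   components, together with the projections onto the components: [gcomp V p]
   is the projection onto V^p, followed by the inclusion. *)
Record gmod (k : comPzRingType) := GMod {
  gsort :> lmodType k;
  gcomp : int -> {linear gsort -> gsort};
  gcomp_orth : forall p q x, gcomp p (gcomp q x) = gcomp q x *+ (p == q);
  gcomp_fin : forall x, finite_set [set p | gcomp p x != 0];
  gcomp_sum : forall x, x = \sum_(p \in [set: int]) gcomp p x }.

Section Graded.
Variable k : comPzRingType.
Implicit Types (U V W : gmod k) (p q n : int).

(* x belongs to V^p. *)
Definition homog V p (x : V) : Prop := gcomp V p x = x.

Definition degree V W n (f : V -> W) : Prop :=
  forall p x, homog p x -> homog (p + n) (f x).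

(* The linear map x |-> (-1)^(n|x|) x; see [koszul_homog]. *)
Definition koszul V n (x : V) : V :=
  \sum_(p \in [set: int]) (-1) ^+ absz (n * p) *: gcomp V p x.

(* The tensor product of f and g, where g has degree n:
   (f ⊗ g)(x ⊗ y) = (-1)^(n|x|) f(x) ⊗ g(y). *)
Definition gtmap U V (U' V' : lmodType k) n (f : U -> U') (g : V -> V') :
  tensor U V -> tensor U' V' := tmap (fun x => f (koszul n x)) g.

(* t belongs to (V ⊗ W)^n *)
Definition tensor_homog V W n (t : tensor V W) : Prop :=
  exists2 s : seq (V * W), t = \sum_(z <- s) tens z.1 z.2
  & forall z, z \in s -> exists p, homog p z.1 /\ homog (n - p) z.2.

(* The letters of u are homogeneous, of total degree n. *)
Fixpoint word_homog V n (u : seq V) : Prop :=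
  if u is x :: u' then exists p, homog p x /\ word_homog (n - p) u' else n = 0.

Lemma fsbig_seqT (V : lmodType k) (F : int -> V) (s : seq int) : uniq s ->
  (forall p, p \notin s -> F p = 0) -> \sum_(p \in [set: int]) F p = \sum_(p <- s) F p.
Proof.
move=> us F0; rewrite (@fsbigE _ _ _ _ _ s) // => [|p _]; last exact: F0.
by apply: eq_bigl => p; rewrite in_setT.
Qed.

Lemma gcomp_supp V (x : V) : exists2 s : seq int, uniq s &
  forall p, p \notin s -> gcomp V p x = 0.
Proof.
have /finite_fsetP [s Hs] := gcomp_fin x.
exists (finmap.enum_fset s); first exact: finmap.fset_uniq.
move=> p ps; apply/eqP/negP => /negP H; move/negP: ps; apply.
have : [set p | gcomp V p x != 0]%classic p by [].
by rewrite Hs.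
Qed.

Lemma gcomp_seq V (x : V) (s : seq int) : uniq s ->
  (forall p, p \notin s -> gcomp V p x = 0) -> x = \sum_(p <- s) gcomp V p x.
Proof. by move=> us s0; rewrite {1}[x]gcomp_sum (fsbig_seqT us). Qed.

Lemma homog_gcomp V p (x : V) : homog p (gcomp V p x).
Proof. by rewrite /homog gcomp_orth eqxx. Qed.

Lemma gcomp_homog V p q (x : V) : homog q x -> gcomp V p x = x *+ (p == q).
Proof. by move=> xq; rewrite -xq gcomp_orth. Qed.

Lemma degree_gcomp V W n (f : {linear V -> W}) p (x : V) :
  degree n f -> gcomp W (p + n) (f x) = f (gcomp V p x).
Proof.
move=> fn; have [s us s0] := gcomp_supp x.
rewrite {1}(gcomp_seq us s0) !linear_sum /=.
have E q : gcomp W (p + n) (f (gcomp V q x)) = f (gcomp V q x) *+ (p == q).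
  have := gcomp_homog (p + n) (fn q _ (homog_gcomp q x)).
  by rewrite (inj_eq (addIr n)).
under eq_bigr do rewrite E.
have [ps|/[dup] /s0 -> ps] := boolP (p \in s).
  rewrite (bigD1_seq p) //= eqxx big1 ?addr0 // => q.
  by rewrite eq_sym => /negPf ->.
rewrite linear0 big_seq big1 // => q qs.
by case: eqP => // pq; rewrite pq qs in ps.
Qed.

Lemma koszul_seq V n (x : V) (s : seq int) : uniq s ->
  (forall p, p \notin s -> gcomp V p x = 0) ->
  koszul n x = \sum_(p <- s) (-1) ^+ absz (n * p) *: gcomp V p x.
Proof.
by move=> us s0; rewrite /koszul (fsbig_seqT us) // => p /s0 ->; rewrite scaler0.
Qed.

Lemma koszul_homog V n p (x : V) : homog p x -> koszul n x = (-1) ^+ absz (n * p) *: x.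
Proof.
move=> xp; rewrite (@koszul_seq _ _ _ [:: p]) // ?big_seq1 ?xp // => q.
by rewrite inE (gcomp_homog q xp) => /negPf ->.
Qed.

Lemma koszul_linear V n : linear (@koszul V n).
Proof.
move=> a x y; have [s us s0] := gcomp_supp x; have [t ut t0] := gcomp_supp y.
have u0 : uniq (undup (s ++ t)) by exact: undup_uniq.
have H p : p \notin undup (s ++ t) -> gcomp V p x = 0 /\ gcomp V p y = 0.
  by rewrite mem_undup mem_cat negb_or => /andP[/s0 -> /t0 ->].
rewrite !(koszul_seq _ u0); last 3 first.
- by move=> p /H[].
- by move=> p /H[].
- by move=> p /H[x0 y0]; rewrite linearP x0 y0 scaler0 addr0.
rewrite scaler_sumr -big_split; apply: eq_bigr => p _ /=.
by rewrite linearP scalerDr !scalerA mulrC.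
Qed.

Lemma gmodP (V : lmodType k) (c : int -> V -> V) (x : V) (s : seq int) :
  uniq s -> (forall p, p \notin s -> c p x = 0) -> x = \sum_(p <- s) c p x ->
  finite_set [set p | c p x != 0] /\ x = \sum_(p \in [set: int]) c p x.
Proof.
move=> us s0 xs; split; last by rewrite (fsbig_seqT us).
apply: (@sub_finite_set _ _ [set` s]%classic); last exact: finite_seq.
by move=> p /= H; apply: contraNT H => /s0 ->.
Qed.

Section Unit.
Let c p : k^o -> k^o := fun a => a *+ (p == 0).
Fact gunit_linear p : linear (c p).
Proof. by move=> a x y; rewrite /c; case: eqP => // _; rewrite scaler0 addr0. Qed.
Fact gunit_orth p q x : c p (c q x) = c q x *+ (p == q).
Proof.
rewrite /c; have [->|q0] := eqVneq q 0; first by [].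
by rewrite !mul0rn.
Qed.
Fact gunitP x : finite_set [set p | c p x != 0] /\ x = \sum_(p \in [set: int]) c p x.
Proof.
apply: (@gmodP _ c x [:: 0]) => [//|p|]; first by rewrite inE /c => /negPf ->.
by rewrite big_seq1 /c eqxx.
Qed.
Definition gunit : gmod k :=
  @GMod k k^o (fun p => mklin (gunit_linear p)) gunit_orth
    (fun x => (gunitP x).1) (fun x => (gunitP x).2).
End Unit.

(* [gshift n V] is S^n V, with (S^n V)^p = V^(p + n). *)
Section Shift.
Variables (n : int) (V : gmod k).
Let c p : {linear V -> V} := gcomp V (p + n).
Fact gshift_orth p q x : c p (c q x) = c q x *+ (p == q).
Proof. by rewrite /c gcomp_orth (inj_eq (addIr n)). Qed.
Fact gshiftP x : finite_set [set p | c p x != 0] /\ x = \sum_(p \in [set: int]) c p x.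
Proof.
have [s us s0] := gcomp_supp x.
apply: (@gmodP _ c x [seq p - n | p <- s]).
- by rewrite map_inj_uniq //; apply: addIr.
- by move=> p H; apply: s0; apply: contra H => ps; apply/mapP; exists (p + n); rewrite ?addrK.
- rewrite big_map {1}(gcomp_seq us s0); apply: eq_bigr => p _.
  by rewrite /c subrK.
Qed.
Definition gshift : gmod k :=
  @GMod k V c gshift_orth (fun x => (gshiftP x).1) (fun x => (gshiftP x).2).
End Shift.

(* The maps s : V -> SV, w : SV -> V and w : V -> S^-1 V are the identity on
   total modules. *)
Definition susp V (x : V) : gshift 1 V := x.
Definition desusp V (x : gshift 1 V) : V := x.
Definition desuspV V (x : V) : gshift (-1) V := x.

(* The cokernel of a degree 0 map; its degree p component is the cokernel of
   the degree p component of the map. *)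
Section Coker.
Variables (U V : gmod k) (e : {linear U -> V}) (e0 : degree 0 e).
Let c p : coker e -> coker e := plift (fun x => coker_pr e (gcomp V p x)).

Fact gcoker_adm p : coker_adm e (fun x => coker_pr e (gcomp V p x)).
Proof.
have [L K] := coker_pr_adm e; split=> [a x y|u]; first by rewrite linearP L.
by rewrite -[p]addr0 (degree_gcomp _ _ e0) K.
Qed.
Fact gcoker_linear p : linear (c p).
Proof. exact/plift_linear/gcoker_adm. Qed.
Fact gcoker_pr p x : c p (coker_pr e x) = coker_pr e (gcomp V p x).
Proof. exact/plift_gen/gcoker_adm. Qed.
Lemma coker_pr_linear : linear (coker_pr e).
Proof. by case: (coker_pr_adm e). Qed.
Lemma coker_pr_surj (x : coker e) : exists y, x = coker_pr e y.
Proof.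
rewrite [x]presented_gen; exists (\sum_(t <- repr x) t.1 *: t.2).
rewrite -[RHS]/(mklin coker_pr_linear _) linear_sum.
by apply: eq_bigr => t _; rewrite linearZ.
Qed.
Fact gcoker_orth p q x : c p (c q x) = c q x *+ (p == q).
Proof.
have [y ->] := coker_pr_surj x; rewrite !gcoker_pr gcomp_orth.
by rewrite -![coker_pr e _]/(mklin coker_pr_linear _) linearMn.
Qed.
Fact gcokerP x : finite_set [set p | c p x != 0] /\ x = \sum_(p \in [set: int]) c p x.
Proof.
have [y ->] := coker_pr_surj x; have [s us s0] := gcomp_supp y.
have pr0 : coker_pr e 0 = 0 by exact: (linear0 (mklin coker_pr_linear)).
apply: (@gmodP _ c _ s us) => [p /s0|]; first by rewrite gcoker_pr => ->.
under eq_bigr do rewrite gcoker_pr.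
rewrite {1}(gcomp_seq us s0).
exact: (linear_sum (mklin coker_pr_linear)).
Qed.
Definition gcoker : gmod k :=
  @GMod k (coker e) (fun p => mklin (gcoker_linear p)) gcoker_orth
    (fun x => (gcokerP x).1) (fun x => (gcokerP x).2).
End Coker.

End Graded.

Record curved_dga (k : comPzRingType) := CurvedDga {
  alg_mod :> gmod k;
  amul : alg_mod -> alg_mod -> alg_mod;
  curv : alg_mod;
  adiff : {linear alg_mod -> alg_mod};
  amul_linl : forall y, linear (amul^~ y);
  amul_linr : forall x, linear (amul x);
  amul_homog : forall p q x y, homog p x -> homog q y -> homog (p + q) (amul x y);
  amulA : associative amul;
  curv_homog : homog 2 curv;
  adiff_deg : degree 1 adiff;
  adiff_curv : adiff curv = 0;
  adiff_sqr : forall a, adiff (adiff a) = amul curv a - amul a curv;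
  adiff_mul : forall p a b, homog p a ->
    adiff (amul a b) = amul (adiff a) b + (-1) ^+ absz p *: amul a (adiff b) }.

Record alg_mor (k : comPzRingType) (A B : curved_dga k) := AlgMor {
  alg_fun :> {linear A -> B};
  alg_mor_deg : degree 0 alg_fun;
  alg_mor_curv : alg_fun (curv A) = curv B;
  alg_mor_mul : forall x y, alg_fun (amul x y) = amul (alg_fun x) (alg_fun y);
  alg_mor_diff : forall x, alg_fun (adiff A x) = adiff B (alg_fun x) }.

Section AlgCat.
Variable k : comPzRingType.

Lemma alg_mor_ext (A B : curved_dga k) (f g : alg_mor A B) : f =1 g -> f = g.
Proof.
case: f g => f f1 f2 f3 f4 [g g1 g2 g3 g4] /= /linear_ext fg; subst g.
by congr AlgMor; apply: Prop_irrelevance.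
Qed.

Program Definition alg_id (A : curved_dga k) : alg_mor A A :=
  @AlgMor k A A idfun _ _ _ _.
Next Obligation. by move=> A p x; rewrite addr0. Qed.
Next Obligation. by []. Qed.
Next Obligation. by []. Qed.
Next Obligation. by []. Qed.

Program Definition alg_cmp (A B C : curved_dga k) (g : alg_mor B C) (f : alg_mor A B) :
  alg_mor A C := @AlgMor k A C (g \o f) _ _ _ _.
Next Obligation.
move=> A B C g f p x xp /=; rewrite -[p + 0]addr0.
exact/alg_mor_deg/alg_mor_deg.
Qed.
Next Obligation. by move=> A B C g f /=; rewrite !alg_mor_curv. Qed.
Next Obligation. by move=> A B C g f x y /=; rewrite !alg_mor_mul. Qed.
Next Obligation. by move=> A B C g f x /=; rewrite !alg_mor_diff. Qed.

Program Definition Alg02 : category :=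
  @Category (curved_dga k) (@alg_mor k) alg_id alg_cmp _ _ _.
Next Obligation. by move=> *; apply: alg_mor_ext. Qed.
Next Obligation. by move=> *; apply: alg_mor_ext. Qed.
Next Obligation. by move=> *; apply: alg_mor_ext. Qed.
End AlgCat.

Record ga_cdg (k : comPzRingType) := GaCdg {
  coalg_mod :> gmod k;
  comul : {linear coalg_mod -> tensor coalg_mod coalg_mod};
  counit : {linear coalg_mod -> gunit k};
  augm : {linear gunit k -> coalg_mod};
  codiff : {linear coalg_mod -> coalg_mod};
  comul_deg : forall n x, homog n x -> tensor_homog n (comul x);
  comulA : forall x,
    tassoc (tmap comul idfun (comul x)) = tmap idfun comul (comul x);
  counit_deg : degree 0 counit;
  counitl : forall x, tlift (fun y z => (counit y : k) *: z) (comul x) = x;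
  counitr : forall x, tlift (fun y z => (counit z : k) *: y) (comul x) = x;
  augm_deg : degree 0 augm;
  augm_comul : comul (augm (1 : k)) = tens (augm (1 : k)) (augm (1 : k));
  augm_counit : counit (augm (1 : k)) = (1 : k);
  codiff_deg : degree 1 codiff;
  codiff_sqr : forall x, codiff (codiff x) = 0;
  codiff_comul : forall x,
    comul (codiff x) = tmap codiff idfun (comul x) + gtmap 1 idfun codiff (comul x);
  codiff_counit : forall x, counit (codiff x) = 0 }.

Section Reduced.
Variables (k : comPzRingType) (C : ga_cdg k).

Definition red_coalg : gmod k := gcoker (@augm_deg k C).

Definition red_pr (x : C) : red_coalg := coker_pr (augm C) x.

Definition red_comul : red_coalg -> tensor red_coalg red_coalg :=
  plift (fun x => tmap red_pr red_pr (comul C x)).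

Lemma red_comul_pr x : red_comul (red_pr x) = tmap red_pr red_pr (comul C x).
Proof.
pose P : {linear C -> red_coalg} := mklin (coker_pr_linear (augm C)).
apply: plift_gen; split=> [a y z|a].
  by rewrite linearP -![tmap _ _ _]/(mklin (tmap_linear P P) _) linearP.
have -> : a = a *: (1 : k^o) by rewrite -[RHS]/(a * 1) mulr1.
rewrite !linearZ /= augm_comul -[tmap _ _ _]/(mklin (tmap_linear P P) _) linearZ /=.
have P0 : P (augm C (1 : k)) = 0 by case: (coker_pr_adm (augm C)) => _; apply.
rewrite (tmap_tens P P) P0.
have [H _] := tens_bilin red_coalg red_coalg.
by rewrite -[tens 0 0]/(mklin (H 0) 0) linear0 scaler0.
Qed.

(* The iterated comultiplication, with values in the (n + 1)-st tensor power. *)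
Fixpoint red_comul_iter (n : nat) : red_coalg -> tpow red_coalg n :=
  if n is n'.+1 then fun x => tmap idfun (red_comul_iter n') (red_comul x)
  else idfun.

Definition cocomplete : Prop := forall x, exists n, red_comul_iter n x = 0.
End Reduced.

Record cga_cdg (k : comPzRingType) := CgaCdgObj {
  ga_coalg :> ga_cdg k;
  ga_cocomplete : cocomplete ga_coalg }.

Record coalg_mor (k : comPzRingType) (C D : cga_cdg k) := CoalgMor {
  coalg_fun :> {linear C -> D};
  coalg_mor_deg : degree 0 coalg_fun;
  coalg_mor_comul : forall x,
    comul D (coalg_fun x) = tmap coalg_fun coalg_fun (comul C x);
  coalg_mor_counit : forall x, counit D (coalg_fun x) = counit C x;
  coalg_mor_augm : forall a, coalg_fun (augm C a) = augm D a;
  coalg_mor_codiff : forall x, coalg_fun (codiff C x) = codiff D (coalg_fun x) }.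

Section CoalgCat.
Variable k : comPzRingType.

Lemma coalg_mor_ext (C D : cga_cdg k) (f g : coalg_mor C D) : f =1 g -> f = g.
Proof.
case: f g => f f1 f2 f3 f4 f5 [g g1 g2 g3 g4 g5] /= /linear_ext fg; subst g.
by congr CoalgMor; apply: Prop_irrelevance.
Qed.

Program Definition coalg_id (C : cga_cdg k) : coalg_mor C C :=
  @CoalgMor k C C idfun _ _ _ _ _.
Next Obligation. by move=> C p x; rewrite addr0. Qed.
Next Obligation. by move=> C x /=; rewrite (tmap_id (comul C x)). Qed.
Next Obligation. by []. Qed.
Next Obligation. by []. Qed.
Next Obligation. by []. Qed.

Program Definition coalg_cmp (C D E : cga_cdg k) (g : coalg_mor D E) (f : coalg_mor C D) :
  coalg_mor C E := @CoalgMor k C E (g \o f) _ _ _ _ _.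
Next Obligation.
move=> C D E g f p x xp /=; rewrite -[p + 0]addr0.
exact/coalg_mor_deg/coalg_mor_deg.
Qed.
Next Obligation. by move=> C D E g f x /=; rewrite !coalg_mor_comul tmap_comp. Qed.
Next Obligation. by move=> C D E g f x /=; rewrite !coalg_mor_counit. Qed.
Next Obligation. by move=> C D E g f a /=; rewrite !coalg_mor_augm. Qed.
Next Obligation. by move=> C D E g f x /=; rewrite !coalg_mor_codiff. Qed.

Program Definition CgaCdg : category :=
  @Category (cga_cdg k) (@coalg_mor k) coalg_id coalg_cmp _ _ _.
Next Obligation. by move=> *; apply: coalg_mor_ext. Qed.
Next Obligation. by move=> *; apply: coalg_mor_ext. Qed.
Next Obligation. by move=> *; apply: coalg_mor_ext. Qed.
End CoalgCat.

Record Tw (k : comPzRingType) (C : cga_cdg k) (A : curved_dga k) := TwCochain {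
  tw_fun :> {linear C -> A};
  tw_deg : degree 1 tw_fun;
  tw_augm : forall a, tw_fun (augm C a) = 0;
  tw_eq : forall x,
    (counit C x : k) *: curv A + (adiff A (tw_fun x) + tw_fun (codiff C x))
      + tlift (@amul k A) (gtmap 1 tw_fun tw_fun (comul C x)) = 0 }.

Section BarCobar.
Variable k : comPzRingType.

(* -s m_i w^{⊗i} for i = 0, 1, 2, as a map on words in SA. *)
Definition bar_comp (A : curved_dga k) (u : seq (gshift 1 A)) : gshift 1 A :=
  match u with
  | [::] => - susp (curv A)
  | [:: x] => - susp (adiff A (desusp x))
  | [:: x; y] => - susp (amul (desusp (koszul 1 x)) (desusp y))
  | _ => 0
  end.

(* X, with the structure map t, is the bar construction of A: as a
   graded-augmented coalgebra X is identified by phi with the tensor module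
   T(SA) with deconcatenation; t is the projection to SA followed by w; and the
   projection to SA of the codifferential is given by [bar_comp] (its projection
   to k, the counit, vanishes by [codiff_counit]). *)
Definition is_bar_obj (A : curved_dga k) (X : cga_cdg k) (t : Tw X A) : Prop :=
  exists phi : {linear tensor_alg (gshift 1 A) -> X}, bijective phi /\
  forall u : seq (gshift 1 A),
    [/\ forall n, word_homog n u -> homog n (phi (word u)),
        comul X (phi (word u)) =
          \sum_(i < (size u).+1) tens (phi (word (take i u))) (phi (word (drop i u))),
        counit X (phi (word u)) = ((u == [::])%:R : k)
          /\ augm X (1 : k) = phi (word [::]),
        t (phi (word u)) = (if u is [:: x] then desusp x else 0)
      & t (codiff X (phi (word u))) = desusp (bar_comp u)].

(* t is a universal element of the functor C |-> Tw(C, A), so that f |-> t \o f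
   is a natural bijection from the morphisms C -> X to Tw(C, A). *)
Definition tw_represents (A : curved_dga k) (X : cga_cdg k) (t : Tw X A) : Prop :=
  forall (C : cga_cdg k) (t' : Tw C A),
    exists! f : coalg_mor C X, forall x, t (f x) = t' x.

Definition is_bar (B : functor (Alg02 k) (CgaCdg k)) : Prop :=
  exists t : forall A : curved_dga k, Tw (B A) A,
    [/\ forall A, is_bar_obj (t A),
        forall A, tw_represents (t A)
      & forall (A A' : curved_dga k) (f : alg_mor A A') x,
          t A' ((fmap B f : coalg_mor _ _) x) = f (t A x)].

(* Y, with the structure map t, has the reduced tensor algebra of the
   desuspension of the reduced coalgebra of C as underlying graded algebra. *)
Definition is_cobar_obj (C : cga_cdg k) (Y : curved_dga k) (t : Tw C Y) : Prop :=
  exists psi : {linear red_tensor_alg (gshift (-1) (red_coalg C)) -> Y},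
    [/\ bijective psi,
        forall n u, u != [::] -> word_homog n u -> homog n (psi (red_word u)),
        forall u v, u != [::] -> v != [::] ->
          psi (red_word (u ++ v)) = amul (psi (red_word u)) (psi (red_word v))
      & forall x, t x = psi (red_word [:: desuspV (red_pr x)])].

Definition tw_corepresents (C : cga_cdg k) (Y : curved_dga k) (t : Tw C Y) : Prop :=
  forall (A : curved_dga k) (t' : Tw C A),
    exists! f : alg_mor Y A, forall x, f (t x) = t' x.

Definition is_cobar (Omega : functor (CgaCdg k) (Alg02 k)) : Prop :=
  exists t : forall C : cga_cdg k, Tw C (Omega C),
    [/\ forall C, is_cobar_obj (t C),
        forall C, tw_corepresents (t C)
      & forall (C C' : cga_cdg k) (g : coalg_mor C C') x,
          (fmap Omega g : alg_mor _ _) (t C x) = t C' (g x)].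
End BarCobar.

(* Main.v *)
Require Import Defs.
From mathcomp Require Import all_boot all_order all_algebra.
From mathcomp Require Import boolp classical_sets cardinality fsbigop functions.
From mathcomp Require Import zify ring.

Set Implicit Arguments.
Unset Strict Implicit.
Unset Printing Implicit Defensive.

Import GRing.Theory.
Local Open Scope ring_scope.
Local Obligation Tactic := idtac.

(** The functors B and Omega are adjoint because both Hom(Omega C, A) and
Hom(C, BA) are naturally the set Tw(C, A) of twisting cochains: the bijections
are composition with the universal cochains, hence natural by associativity of
composition ([bar_cobar_adjoint]). The substance is that the concrete bar and
cobar constructions exist and (co)represent Tw.

For the bar construction, the tensor coalgebra T(V) is cofree among cocomplete
coalgebras. A degree 0 map tau from C to V killing the augmentation extends to
the coalgebra map f that solves f = eta.1 + tau.f, where eta is the counit of C,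
1 is the empty word, and tau.f is the convolution that prepends a letter. This f
is a sum over word lengths which is locally finite by cocompleteness
([cofree_map_exists]), and it is comultiplicative since such fixed point
equations have a unique solution ([cofree_comul]). Moreover T(V) is rigid
([skew_comul_eq0]): a map h into it with Delta h = (h * f) + (g * h), for * the
convolution with values in the tensor square, vanishes as soon as its components
in k and V do. Applied to differences of coalgebra maps this gives uniqueness;
applied to the commutator of f with the codifferentials it gives compatibility; applied to the
square of the bar codifferential [bdiff] it reduces D^2 = 0 to the component
in V.

That component, and also the square of the cobar differential, are computed by
one lemma, [mc_square]: if d tau + tau D + eta.c + tau * tau = 0, up to Koszul signs,
for a derivation d and a coderivation D, then d^2 tau = tau D^2 + [c, tau]. For
the bar construction d^2 = [c, -] is known and D^2 = 0 on letters follows; for the cobar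
construction D^2 = 0 is known and d^2 = [c, -] on letters follows, and then
everywhere since the algebra is free. Corepresentability of the cobar
construction is freeness, the differential on letters being forced by the
twisting cochain equation ([cobar_tw_corepresents]).

Linear maps out of tensor algebras are built by structural recursion on words
([talg_rec], [ralg_rec]), and identities between them are proved by the
corresponding inductions ([talg_ind], [ralg_ind]). *)

(** * Bilinear maps and tensor products *)

Section Bilinear.
Variable k : comPzRingType.
Implicit Types U V W M : lmodType k.

Fact lin_sig U V (f : U -> V) : linear f -> {h : {linear U -> V} | h =1 f}.
Proof. by move=> fL; exists (mklin fL). Qed.
(** Sealed, so that simplification does not unfold the bundled map. *)
Definition lin U V (f : U -> V) (fL : linear f) : {linear U -> V} := sval (lin_sig fL).
Lemma linE U V (f : U -> V) (fL : linear f) : lin fL =1 f.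
Proof. exact: svalP (lin_sig fL). Qed.

Fact plin_sig (X : choiceType) (adm : forall M : lmodType k, (X -> M) -> Prop) M
  (f : X -> M) : adm M f -> {h : {linear presented adm -> M} | forall x, h (gen x) = f x}.
Proof. by move=> af; exists (mklin (plift_linear af)) => x; exact: plift_gen. Qed.
Definition plin (X : choiceType) (adm : forall M : lmodType k, (X -> M) -> Prop) M
  (f : X -> M) (af : adm M f) : {linear presented adm -> M} := sval (plin_sig af).
Lemma plin_gen (X : choiceType) (adm : forall M : lmodType k, (X -> M) -> Prop) M
  (f : X -> M) (af : adm M f) x : plin af (gen x) = f x.
Proof. exact: svalP (plin_sig af) x. Qed.

Record bilmap U V M := Bilmap {
  bfun :> U -> V -> M;
  bil_l : forall y, linear (bfun^~ y);
  bil_r : forall x, linear (bfun x) }.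

Section Theory.
Variables (U V M : lmodType k) (f : bilmap U V M).
Definition bapl y : {linear U -> M} := lin (bil_l f y).
Definition bapr x : {linear V -> M} := lin (bil_r f x).
Lemma baplE y x : bapl y x = f x y. Proof. exact: linE. Qed.
Lemma baprE x y : bapr x y = f x y. Proof. exact: linE. Qed.
Lemma bDl x x' y : f (x + x') y = f x y + f x' y.
Proof. by rewrite -!baplE linearD. Qed.
Lemma bDr x y y' : f x (y + y') = f x y + f x y'.
Proof. by rewrite -!baprE linearD. Qed.
Lemma bZl a x y : f (a *: x) y = a *: f x y.
Proof. by rewrite -!baplE linearZ_LR. Qed.
Lemma bZr a x y : f x (a *: y) = a *: f x y.
Proof. by rewrite -!baprE linearZ_LR. Qed.
Lemma b0l y : f 0 y = 0.
Proof. by rewrite -!baplE linear0. Qed.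
Lemma b0r x : f x 0 = 0.
Proof. by rewrite -!baprE linear0. Qed.
Lemma bNl x y : f (- x) y = - f x y.
Proof. by rewrite -!baplE linearN. Qed.
Lemma bNr x y : f x (- y) = - f x y.
Proof. by rewrite -!baprE linearN. Qed.
Lemma bsuml I r (P : pred I) (F : I -> U) y :
  f (\sum_(i <- r | P i) F i) y = \sum_(i <- r | P i) f (F i) y.
Proof. by rewrite -!baplE linear_sum; under [RHS]eq_bigr do rewrite -baplE. Qed.
Lemma bsumr I r (P : pred I) (F : I -> V) x :
  f x (\sum_(i <- r | P i) F i) = \sum_(i <- r | P i) f x (F i).
Proof. by rewrite -!baprE linear_sum; under [RHS]eq_bigr do rewrite -baprE. Qed.
Lemma bil_bilin : bilin (fun z => f z.1 z.2).
Proof. by split=> [y|x]; [exact: bil_l | exact: bil_r]. Qed.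
End Theory.

Definition btens U V : bilmap U V (tensor U V) :=
  Bilmap (tens_bilin U V).1 (tens_bilin U V).2.

Lemma btensE U V (x : U) (y : V) : btens U V x y = tens x y. Proof. by []. Qed.
Lemma tensDl U V (x x' : U) (y : V) : tens (x + x') y = tens x y + tens x' y.
Proof. exact: (bDl (btens U V)). Qed.
Lemma tensDr U V (x : U) (y y' : V) : tens x (y + y') = tens x y + tens x y'.
Proof. exact: (bDr (btens U V)). Qed.
Lemma tensZl U V a (x : U) (y : V) : tens (a *: x) y = a *: tens x y.
Proof. exact: (bZl (btens U V)). Qed.
Lemma tensZr U V a (x : U) (y : V) : tens x (a *: y) = a *: tens x y.
Proof. exact: (bZr (btens U V)). Qed.
Lemma tensNl U V (x : U) (y : V) : tens (- x) y = - tens x y.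
Proof. exact: (bNl (btens U V)). Qed.
Lemma tensNr U V (x : U) (y : V) : tens x (- y) = - tens x y.
Proof. exact: (bNr (btens U V)). Qed.
Lemma tens0l U V (y : V) : tens (0 : U) y = 0.
Proof. exact: (b0l (btens U V)). Qed.
Lemma tens0r U V (x : U) : tens x (0 : V) = 0.
Proof. exact: (b0r (btens U V)). Qed.

Lemma tens_sumr U V I r (P : pred I) (F : I -> V) (x : U) :
  tens x (\sum_(i <- r | P i) F i) = \sum_(i <- r | P i) tens x (F i).
Proof. exact: (bsumr (btens U V)). Qed.

Definition blift U V M (f : bilmap U V M) : {linear tensor U V -> M} :=
  lin (plift_linear (bil_bilin f)).

Lemma bliftE U V M (f : bilmap U V M) t : tlift f t = blift f t.
Proof. exact/esym/linE. Qed.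

Lemma blift_tens U V M (f : bilmap U V M) x y : blift f (tens x y) = f x y.
Proof. by rewrite -bliftE (tlift_tens x y (bil_bilin f)). Qed.

Definition tmapl U V U' V' (f : {linear U -> U'}) (g : {linear V -> V'}) :
  {linear tensor U V -> tensor U' V'} := lin (tmap_linear f g).

Lemma tmaplE U V U' V' (f : {linear U -> U'}) (g : {linear V -> V'}) t :
  tmap f g t = tmapl f g t.
Proof. exact/esym/linE. Qed.

Lemma tmapl_tens U V U' V' (f : {linear U -> U'}) (g : {linear V -> V'}) x y :
  tmapl f g (tens x y) = tens (f x) (g y).
Proof. by rewrite -tmaplE tmap_tens. Qed.

Lemma tensor_sum U V (t : tensor U V) :
  exists s : seq (U * V), t = \sum_(z <- s) tens z.1 z.2.
Proof.
rewrite [t]presented_gen; elim: (repr t) => [|[a [x y]] s [s' E]].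
  by exists [::]; rewrite !big_nil.
exists ((a *: x, y) :: s'); rewrite !big_cons E /=; congr (_ + _).
by rewrite tensZl.
Qed.

Program Definition bcomp U V U' V' M M' (h : {linear M -> M'}) (f : bilmap U V M)
    (g : {linear U' -> U}) (g' : {linear V' -> V}) : bilmap U' V' M' :=
  Bilmap (bfun := fun x y => h (f (g x) (g' y))) _ _.
Next Obligation. by move=> * a x z; rewrite /= linearP bDl bZl linearP. Qed.
Next Obligation. by move=> * a x z; rewrite /= linearP bDr bZr linearP. Qed.

Program Definition badd U V M (f g : bilmap U V M) : bilmap U V M :=
  Bilmap (bfun := fun x y => f x y + g x y) _ _.
Next Obligation.
by move=> * a x z; rewrite /= !bDl !bZl scalerDr !addrA; congr (_ + _); rewrite addrAC.
Qed.
Next Obligation.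
by move=> * a x z; rewrite /= !bDr !bZr scalerDr !addrA; congr (_ + _); rewrite addrAC.
Qed.

Program Definition bzero U V M : bilmap U V M := Bilmap (bfun := fun _ _ => 0) _ _.
Next Obligation. by move=> * a x z; rewrite scaler0 addr0. Qed.
Next Obligation. by move=> * a x z; rewrite scaler0 addr0. Qed.

Program Definition bscale V U (M : lmodType k) (f : {linear V -> k^o}) (g : {linear U -> M}) :
  bilmap U V M := Bilmap (bfun := fun x y => (f y : k) *: g x) _ _.
Next Obligation.
by move=> V U M f g y a x z; rewrite linearP scalerDr !scalerA mulrC.
Qed.
Next Obligation.
by move=> V U M f g x a y z; rewrite linearP scalerDl scalerA.
Qed.

Lemma coker_lift U V M (e : {linear U -> V}) (f : {linear V -> M}) :
  (forall u, f (e u) = 0) ->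
  exists g : {linear coker e -> M}, forall x, g (coker_pr e x) = f x.
Proof.
move=> fe; have af : coker_adm e f by split=> // a x y; rewrite linearP.
by exists (plin af) => x; exact: plin_gen.
Qed.

End Bilinear.
Arguments btens {k U V}.

(** * Structural recursion on the tensor algebra *)

Section TensorAlgebra.
Variables (k : comPzRingType) (V : lmodType k).
Local Notation T := (tensor_alg V).

Let cons_words v : seq V -> T := fun u => word (v :: u).
Fact cons_multilin v : multilin (cons_words v).
Proof. by move=> u u'; exact: (word_multilin (v :: u) u'). Qed.
Let tconsf v : {linear T -> T} := plin (cons_multilin v).
Fact tconsf_word v u : tconsf v (word u) = word (v :: u).
Proof. exact: plin_gen. Qed.
Fact tcons_linl t : linear (tconsf^~ t).
Proof.
move=> a v v'; pose g := GRing.add_fun (a \*: tconsf v) (tconsf v').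
have := @presented_ext k _ _ _ (tconsf (a *: v + v')) g; apply=> u.
rewrite -[gen u]/(word u) /g /= !tconsf_word; exact: (word_multilin [::] u).
Qed.
Fact tcons_linr v : linear (tconsf v).
Proof. by move=> a t t'; rewrite linearP. Qed.
Fact tcons_sig : {b : bilmap V T T | forall v u, b v (word u) = word (v :: u)}.
Proof. by exists (Bilmap tcons_linl tcons_linr) => v u; exact: tconsf_word. Qed.
Definition tcons : bilmap V T T := sval tcons_sig.
Lemma tcons_word v u : tcons v (word u) = word (v :: u).
Proof. exact: svalP tcons_sig v u. Qed.
Definition tone : T := word [::].

(** Words are built from the empty word by prepending letters, and they span. *)
Lemma talg_ind (P : T -> Prop) :
  (forall a x y, P x -> P y -> P (a *: x + y)) -> P tone ->
  (forall v t, P t -> P (tcons v t)) -> forall t, P t.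
Proof.
move=> PD P1 Pc t.
have P0 : P 0 by have := PD (-1) _ _ P1 P1; rewrite scaleN1r addNr.
rewrite [t]presented_gen; elim: (repr t) => [|[a u] s IH]; first by rewrite big_nil.
rewrite big_cons; apply: PD => //=; rewrite -[gen u]/(word u).
by elim: u => // v u /(Pc v); rewrite tcons_word.
Qed.

(** Primitive recursion on words is multilinear as soon as its step is bilinear,
so it descends to the tensor algebra. *)
Lemma talg_rec (M : lmodType k) (m0 : M) (a : bilmap V T M) (b : bilmap V M M) :
  exists h : {linear T -> M}, h tone = m0 /\ forall v t, h (tcons v t) = a v t + b v (h t).
Proof.
pose hw := fix hw u := if u is v :: u' then a v (word u') + b v (hw u') else m0.
have hm : multilin hw.
  elim=> [|v u IH] u' c x y /=.
    by rewrite !bDl !bZl scalerDr !addrA; congr (_ + _); rewrite addrAC.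
  rewrite (word_multilin u u') IH !bDr !bZr scalerDr !addrA; congr (_ + _).
  by rewrite addrAC.
pose h := plin hm.
have hE u : h (word u) = hw u by exact: plin_gen.
exists h; split=> [|v t]; first exact: hE.
pose L : {linear T -> M} := bapr a v.
pose R : {linear T -> M} := GRing.add_fun L (bapr b v \o h).
suff: (h \o bapr tcons v) t = R t by rewrite /R /L /= !baprE.
have := @presented_ext k _ _ _ (h \o bapr tcons v) R; apply=> u.
by rewrite -[gen u]/(word u) /R /L /= !baprE tcons_word !hE.
Qed.

End TensorAlgebra.
Arguments tone {k V}.
Arguments tcons {k V}.

Section ReducedTensorAlgebra.
Variables (k : comPzRingType) (V : lmodType k).
Local Notation T := (tensor_alg V).
Local Notation R := (red_tensor_alg V).

Let word_or0 (u : seq V) : T := if u is [::] then 0 else word u.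
Fact word_or0_multilin : multilin_red word_or0.
Proof.
by split=> // -[|w u] u' a x y /=; [exact: (word_multilin [::])|exact: (word_multilin (w :: u))].
Qed.
Definition red_incl : {linear R -> T} := plin word_or0_multilin.
Lemma red_incl_word u : red_incl (red_word u) = if u is [::] then 0 else word u.
Proof. exact: plin_gen. Qed.

Definition red_retr : {linear T -> R} :=
  plin (proj1 (red_word_multilin V)).
Lemma red_retr_word u : red_retr (word u) = red_word u.
Proof. exact: plin_gen. Qed.

Lemma red_inclK r : red_retr (red_incl r) = r.
Proof.
have := @presented_ext k _ _ _ (red_retr \o red_incl) idfun; apply=> u.
rewrite -[gen u]/(red_word u) [LHS]/= red_incl_word.
by case: u => [|v u]; rewrite ?red_retr_word // linear0 (proj2 (red_word_multilin V)).
Qed.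

Fact rletter_linear : linear (fun v : V => red_word [:: v]).
Proof. exact: (proj1 (red_word_multilin V) [::] [::]). Qed.
Definition rletter : {linear V -> R} := lin rletter_linear.
Lemma rletterE v : rletter v = red_word [:: v]. Proof. exact: linE. Qed.

(* The empty word is zero in R, so that prepending v to it gives zero and not the
   letter v. *)
Fact rtcons_sig : {b : bilmap V R R |
  forall v u, u != [::] -> b v (red_word u) = red_word (v :: u)}.
Proof.
exists (bcomp red_retr tcons idfun red_incl) => v [//|w u] _.
by rewrite /= red_incl_word tcons_word red_retr_word.
Qed.
Definition rtcons : bilmap V R R := sval rtcons_sig.
Lemma rtcons_word v u : u != [::] -> rtcons v (red_word u) = red_word (v :: u).
Proof. exact: svalP rtcons_sig v u. Qed.

Lemma ralg_ind (P : R -> Prop) :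
  (forall a x y, P x -> P y -> P (a *: x + y)) -> (forall v, P (rletter v)) ->
  (forall v r, P r -> P (rtcons v r)) -> forall r, P r.
Proof.
move=> PD P1 Pc r.
have P0 : P 0 by have := PD (-1) _ _ (P1 0) (P1 0); rewrite scaleN1r addNr.
rewrite [r]presented_gen; elim: (repr r) => [|[a u] s IH]; first by rewrite big_nil.
rewrite big_cons; apply: PD => //=; rewrite -[gen u]/(red_word u).
elim: u => [|v [|w u] Hu]; last by rewrite -rtcons_word //; apply: Pc.
  by rewrite (proj2 (red_word_multilin V)).
by rewrite -rletterE; apply: P1.
Qed.

Lemma ralg_ext (M : lmodType k) (f g : {linear R -> M}) :
  (forall v, f (rletter v) = g (rletter v)) ->
  (forall v r, f r = g r -> f (rtcons v r) = g (rtcons v r)) -> f =1 g.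
Proof.
move=> f1 fc; apply: ralg_ind => // a x y fx fy.
by rewrite !linearP fx fy.
Qed.

(** Recursion on R is recursion on T in which e, the coefficient of the empty
word, detects that the last letter has been reached. *)
Lemma ralg_rec (M : lmodType k) (f : {linear V -> M}) (a : bilmap V R M) (b : bilmap V M M) :
  exists h : {linear R -> M}, (forall v, h (rletter v) = f v) /\
    forall v r, h (rtcons v r) = a v r + b v (h r).
Proof.
have [e [e1 ec]] := talg_rec (1 : k^o) (bzero V T k^o) (bzero V k^o k^o).
have [h [h1 hc]] :=
  talg_rec 0 (badd (bscale e f) (bcomp idfun a idfun red_retr)) b.
exists (h \o red_incl); split=> [v|v r].
  rewrite /= rletterE red_incl_word -tcons_word hc h1 b0r addr0 /= e1 scale1r.
  by rewrite red_retr_word (proj2 (red_word_multilin V)) b0r addr0.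
pose L : {linear R -> M} := h \o red_incl \o bapr rtcons v.
pose L' : {linear R -> M} := GRing.add_fun (bapr a v) (bapr b v \o h \o red_incl).
suff: L r = L' r by rewrite /L /L' /= !baprE.
have := @presented_ext k _ _ _ L L'; apply=> u.
rewrite -[gen u]/(red_word u) /L /L' /= !baprE; case: u => [|w u].
  by rewrite (proj2 (red_word_multilin V)) !b0r !linear0 !b0r addr0.
rewrite rtcons_word // !red_incl_word -tcons_word hc /= red_retr_word.
by rewrite -tcons_word ec /= add0r scale0r add0r.
Qed.

End ReducedTensorAlgebra.
Arguments rletter {k V}.
Arguments rtcons {k V}.

(** * Graded modules *)

Section GradedTheory.
Variable k : comPzRingType.
Implicit Types U V W : gmod k.

Lemma sgD (p q : int) : (-1) ^+ absz (p + q) = (-1) ^+ absz p * (-1) ^+ absz q :> k.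
Proof.
rewrite -exprD -signr_odd -[in RHS]signr_odd; congr (_ ^+ _).
suff -> : odd `|p + q| = odd (`|p| + `|q|) by [].
lia.
Qed.

Lemma sg2 (p : int) : (-1) ^+ absz p * (-1) ^+ absz p = 1 :> k.
Proof. by rewrite -expr2 sqrr_sign. Qed.

Section Homog.
Variables (V : gmod k) (p : int).
Lemma homogP a (x y : V) : homog p x -> homog p y -> homog p (a *: x + y).
Proof. by rewrite /homog linearP => -> ->. Qed.
Lemma homogD (x y : V) : homog p x -> homog p y -> homog p (x + y).
Proof. by rewrite /homog linearD => -> ->. Qed.
Lemma homogZ a (x : V) : homog p x -> homog p (a *: x).
Proof. by rewrite /homog linearZ => /= ->. Qed.
Lemma homogN (x : V) : homog p x -> homog p (- x).
Proof. by rewrite /homog linearN => ->. Qed.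
Lemma homog0 : homog p (0 : V).
Proof. by rewrite /homog linear0. Qed.
Lemma homog_sum (I : eqType) (s : seq I) (F : I -> V) :
  (forall i, i \in s -> homog p (F i)) -> homog p (\sum_(i <- s) F i).
Proof.
move=> H; rewrite big_seq; elim/big_ind: _ => //; [exact: homog0 | exact: homogD].
Qed.
End Homog.

Lemma homog_ind V (P : V -> Prop) : P 0 -> (forall x y, P x -> P y -> P (x + y)) ->
  (forall p x, homog p x -> P x) -> forall x, P x.
Proof.
move=> P0 PD Ph x; have [s us s0] := gcomp_supp x.
rewrite (gcomp_seq us s0); elim/big_ind: _ => // p _; exact/Ph/homog_gcomp.
Qed.

Lemma homog_ext V (M : lmodType k) (f g : {linear V -> M}) :
  (forall p x, homog p x -> f x = g x) -> f =1 g.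
Proof.
move=> fg; apply: homog_ind => // [|x y fx fy]; first by rewrite !linear0.
by rewrite !linearD fx fy.
Qed.

(** The degree involution x |-> (-1)^|x| x. *)
Definition parity V : {linear V -> V} := lin (@koszul_linear k V 1).
Lemma parityE V x : koszul 1 x = parity V x.
Proof. exact/esym/linE. Qed.
Lemma parity_homog V p (x : V) : homog p x -> parity V x = (-1) ^+ absz p *: x.
Proof. by move=> xp; rewrite -parityE (koszul_homog _ xp) mul1r. Qed.

Lemma parityK V (x : V) : parity V (parity V x) = x.
Proof.
have := @homog_ext V V (parity V \o parity V) idfun; apply=> p y yp.
by rewrite /= (parity_homog yp) linearZ /= (parity_homog yp) scalerA sg2 scale1r.
Qed.

Lemma parity_degree V W n (f : {linear V -> W}) x : degree n f ->
  parity W (f x) = (-1) ^+ absz n *: f (parity V x).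
Proof.
move=> fn; have := @homog_ext V W (parity W \o f) ((-1) ^+ absz n \*: (f \o parity V)).
apply=> p y yp /=; rewrite (parity_homog yp) (parity_homog (fn _ _ yp)) linearZ /=.
by rewrite scalerA sgD mulrC.
Qed.

Lemma parity_degree0 V W (f : {linear V -> W}) x : degree 0 f -> parity W (f x) = f (parity V x).
Proof. by move=> f0; rewrite (parity_degree _ f0) scale1r. Qed.
Lemma parity_degree1 V W (f : {linear V -> W}) x : degree 1 f -> parity W (f x) = - f (parity V x).
Proof. by move=> f0; rewrite (parity_degree _ f0) scaleN1r. Qed.

Lemma parity_degreeV V W n (f : {linear V -> W}) : degree n f -> degree n (f \o parity V).
Proof. by move=> fn p x xp; rewrite /= (parity_homog xp) linearZ; apply/homogZ/fn. Qed.

Lemma gtmapE U V (U' V' : lmodType k) (f : {linear U -> U'}) (g : {linear V -> V'}) t :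
  gtmap 1 f g t = tmapl (f \o parity U) g t.
Proof.
rewrite -tmaplE /gtmap; congr (tmap _ _ _); apply: funext => x.
by rewrite /= parityE.
Qed.

Section TensorHomog.
Variables V W : gmod k.
Lemma tensor_homog0 n : tensor_homog n (0 : tensor V W).
Proof. by exists [::] => //; rewrite big_nil. Qed.
Lemma tensor_homogD n (s t : tensor V W) :
  tensor_homog n s -> tensor_homog n t -> tensor_homog n (s + t).
Proof.
move=> [a -> Ha] [b -> Hb]; exists (a ++ b); first by rewrite big_cat.
by move=> z; rewrite mem_cat => /orP[/Ha|/Hb].
Qed.
Lemma tensor_homog_tens p q (x : V) (y : W) :
  homog p x -> homog q y -> tensor_homog (p + q) (tens x y).
Proof.
move=> xp yq; exists [:: (x, y)]; first by rewrite big_seq1.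
by move=> z; rewrite inE => /eqP->; exists p; rewrite /= addrAC subrr add0r.
Qed.
Lemma tensor_homogZ n a (t : tensor V W) : tensor_homog n t -> tensor_homog n (a *: t).
Proof.
move=> [s -> Hs]; exists [seq (a *: z.1, z.2) | z <- s].
  rewrite big_map scaler_sumr; apply: eq_bigr => z _.
  by rewrite tensZl.
move=> _ /mapP[z /Hs [p [h1 h2]] ->]; exists p; split=> //=; exact: homogZ.
Qed.
End TensorHomog.

Lemma tensor_homog_map V W V' W' n p q (f : {linear V -> V'}) (g : {linear W -> W'}) t :
  degree p f -> degree q g -> tensor_homog n t ->
  tensor_homog (n + p + q) (tmapl f g t).
Proof.
move=> fp gq [s -> Hs]; rewrite linear_sum big_seq.
elim/big_ind: _ => [|x y|z /Hs [r [h1 h2]]].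
- exact: tensor_homog0.
- exact: tensor_homogD.
rewrite tmapl_tens; have -> : n + p + q = (r + p) + (n - r + q) by ring.
exact: tensor_homog_tens (fp _ _ h1) (gq _ _ h2).
Qed.

Lemma blift_homog V W U n m (f : bilmap V W U) t :
  (forall p q x y, homog p x -> homog q y -> homog (p + q + m) (f x y)) ->
  tensor_homog n t -> homog (n + m) (blift f t).
Proof.
move=> H [s -> Hs]; rewrite linear_sum; apply: homog_sum => z /Hs [p [h1 h2]].
rewrite blift_tens; have := H _ _ _ _ h1 h2.
by have -> : p + (n - p) + m = n + m by ring.
Qed.

(** A grading can be specified by projections together with a spanning family
of elements on which these projections are as expected. *)
Section SpanGrading.
Variables (M : lmodType k) (c : int -> {linear M -> M}) (S : int -> M -> Prop).
Hypothesis cS : forall n p y, S n y -> c p y = y *+ (p == n).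
Hypothesis span : forall x, exists2 s : seq M,
  x = \sum_(y <- s) y & forall y, y \in s -> exists n, S n y.

Fact span_orth p q x : c p (c q x) = c q x *+ (p == q).
Proof.
have [s -> Hs] := span x; rewrite !linear_sum -sumrMnl [LHS]big_seq [RHS]big_seq.
apply: eq_bigr => y /Hs [n Sn]; rewrite (cS q Sn) linearMn (cS p Sn) -!mulrnA.
by congr (_ *+ _); case: (eqVneq q n) => [->|_]; rewrite ?muln1 ?mul1n ?muln0.
Qed.

Fact spanP x : finite_set [set p | c p x != 0]%classic /\
  x = \sum_(p \in [set: int]%classic) c p x.
Proof.
have [s -> Hs] := span x.
pose d y := if pselect (exists n, S n y) is left e then projT1 (cid e) else 0.
have dS y : y \in s -> S (d y) y.
  by move=> /Hs H; rewrite /d; case: pselect => // e; case: (cid e).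
apply: (@gmodP _ _ (fun p => c p) _ (undup [seq d y | y <- s])).
- exact: undup_uniq.
- move=> p; rewrite mem_undup => ps; rewrite linear_sum big_seq big1 // => y ys.
  rewrite (cS p (dS _ ys)); case: eqP => // E; move/negP: ps; case.
  by rewrite E; apply: map_f.
under [RHS]eq_bigr do rewrite linear_sum.
rewrite exchange_big /= big_seq [RHS]big_seq; apply: eq_bigr => y ys.
rewrite (bigD1_seq (d y)) ?undup_uniq ?mem_undup ?map_f //= (cS _ (dS _ ys)) eqxx.
by rewrite big1 ?addr0 // => p /negPf pd; rewrite (cS _ (dS _ ys)) pd.
Qed.

Definition span_gmod : gmod k :=
  @GMod k M c span_orth (fun x => (spanP x).1) (fun x => (spanP x).2).

Lemma span_homog n (y : span_gmod) : S n y -> homog n y.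
Proof. by move=> Sn; rewrite /homog /= (cS _ Sn) eqxx. Qed.

Lemma homog_span n (x : span_gmod) : homog n x ->
  exists2 s : seq M, x = \sum_(y <- s) y & forall y, y \in s -> S n y.
Proof.
move=> <-; have [s -> Hs] := span x; exists [seq y <- s | `[< S n y >]]; last first.
  by move=> y; rewrite mem_filter => /andP[/asboolP].
rewrite linear_sum big_filter [RHS]big_mkcond /= !big_seq; apply: eq_bigr => y ys.
case: asboolP => [Sn|nS]; first by rewrite (cS _ Sn) eqxx.
have [m Sm] := Hs _ ys; rewrite (cS _ Sm).
by case: eqP => // E; case: nS; rewrite E.
Qed.

End SpanGrading.

End GradedTheory.

(** * Gradings on tensor algebras *)

Section GradedTensorAlgebra.
Variables (k : comPzRingType) (V : gmod k).
Local Notation T := (tensor_alg V).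
Local Notation R := (red_tensor_alg V).

(* All the components of a word are computed together, as a function of the
   degree, by decomposing one letter at a time. *)
Let gstep (v : V) (m : int -> T) : int -> T :=
  fun n => \sum_(p \in [set: int]%classic) tcons (gcomp V p v) (m (n - p)).

Fact gstep_seq v m n (s : seq int) : uniq s ->
  (forall p, p \notin s -> gcomp V p v = 0) ->
  gstep v m n = \sum_(p <- s) tcons (gcomp V p v) (m (n - p)).
Proof. by move=> us s0; apply: fsbig_seqT => // p /s0 ->; rewrite b0l. Qed.

Fact gstep_linl m : linear (gstep^~ m).
Proof.
move=> a x y; apply: funext => n.
have [s us s0] := gcomp_supp x; have [t ut t0] := gcomp_supp y.
have u0 : uniq (undup (s ++ t)) by exact: undup_uniq.
have H p : p \notin undup (s ++ t) -> gcomp V p x = 0 /\ gcomp V p y = 0.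
  by rewrite mem_undup mem_cat negb_or => /andP[/s0 -> /t0 ->].
rewrite -[RHS]/(a *: gstep x m n + gstep y m n) !(gstep_seq _ _ u0).
- rewrite scaler_sumr -big_split; apply: eq_bigr => p _ /=.
  by rewrite linearP bDl bZl.
- by move=> p /H[].
- by move=> p /H[].
- by move=> p /H[x0 y0]; rewrite linearP x0 y0 scaler0 addr0.
Qed.
Fact gstep_linr v : linear (gstep v).
Proof.
move=> a x y; apply: funext => n; have [s us s0] := gcomp_supp v.
rewrite -[RHS]/(a *: gstep v x n + gstep v y n) !(gstep_seq _ _ us s0).
rewrite scaler_sumr -big_split; apply: eq_bigr => p _ /=.
by rewrite -bZr -bDr.
Qed.
Fact gstep_homog p v m n : homog p v -> gstep v m n = tcons v (m (n - p)).
Proof.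
move=> vp; rewrite (@gstep_seq v m n [:: p]) // ?big_seq1 ?vp // => q.
by rewrite inE (gcomp_homog q vp) => /negPf ->.
Qed.

Fact tgrade_sig : {h : {linear T -> (int -> T)} |
  h tone = (fun n => tone *+ (n == 0)) /\
  forall v t, h (tcons v t) = gstep v (h t)}.
Proof.
apply: cid; have [h [h1 hc]] := talg_rec (fun n => tone *+ (n == 0) : T)
  (bzero V T (int -> T)) (Bilmap gstep_linl gstep_linr).
by exists h; split=> // v t; rewrite hc add0r.
Qed.

Fact tgrade_linear n : linear (fun t => sval tgrade_sig t n).
Proof. by move=> a x y; rewrite linearP. Qed.

Definition tgrade n : {linear T -> T} := lin (tgrade_linear n).

Definition thomog n (y : T) := exists a u, y = a *: word u /\ word_homog n u.

Fact tgrade_word n p u : word_homog n u -> tgrade p (word u) = word u *+ (p == n).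
Proof.
elim: u n p => [|v u IH] n p /=.
  by move=> ->; rewrite linE; have [-> _] := svalP tgrade_sig.
move=> [q [vq un]]; rewrite -tcons_word linE; have [_ ->] := svalP tgrade_sig.
rewrite (gstep_homog _ _ vq); have := IH _ (p - q) un; rewrite linE => ->.
rewrite (inj_eq (addIr _)).
by case: eqP => _; rewrite ?mulr1n // mulr0n b0r.
Qed.

Fact tgrade_thomog n p y : thomog n y -> tgrade p y = y *+ (p == n).
Proof. by move=> [a [u [-> un]]]; rewrite linearZ /= (tgrade_word _ un) scalerMnr. Qed.

Fact thomog_span x : exists2 s : seq T,
  x = \sum_(y <- s) y & forall y, y \in s -> exists n, thomog n y.
Proof.
have PD x' y' : (exists2 s : seq T,
    x' = \sum_(y <- s) y & forall y, y \in s -> exists n, thomog n y) ->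
  (exists2 s : seq T,
    y' = \sum_(y <- s) y & forall y, y \in s -> exists n, thomog n y) ->
  (exists2 s : seq T,
    x' + y' = \sum_(y <- s) y & forall y, y \in s -> exists n, thomog n y).
  move=> [s -> Hs] [t -> Ht]; exists (s ++ t); first by rewrite big_cat.
  by move=> z; rewrite mem_cat => /orP[/Hs|/Ht].
elim/talg_ind: x => [a x y [s -> Hs] Hy||v t [s -> Hs]].
- apply: PD => //; exists [seq a *: z | z <- s]; first by rewrite big_map scaler_sumr.
  move=> _ /mapP[z /Hs[n [b [u [-> un]]]] ->]; exists n, (a * b), u.
  by rewrite scalerA.
- exists [:: tone]; first by rewrite big_seq1.
  by move=> z; rewrite inE => /eqP ->; exists 0, 1, [::]; rewrite scale1r.
elim/homog_ind: v => [|v w Hv Hw|p v vp].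
- by rewrite b0l; exists [::] => //; rewrite big_nil.
- by rewrite bDl; apply: PD.
exists [seq tcons v z | z <- s]; first by rewrite big_map bsumr.
move=> _ /mapP[z /Hs[n [b [u [-> un]]]] ->]; exists (p + n), b, (v :: u).
rewrite bZr tcons_word; split=> //=; exists p; split=> //.
by have -> : p + n - p = n by ring.
Qed.

Definition tgr : gmod k := span_gmod tgrade_thomog thomog_span.

Lemma word_homogP n u : word_homog n u -> homog n (word u : tgr).
Proof. by move=> un; apply: span_homog; exists 1, u; rewrite scale1r. Qed.

Lemma tone_homog : homog 0 (tone : tgr).
Proof. exact: word_homogP. Qed.

Lemma tgr_homog_ind (P : int -> T -> Prop) :
  (forall n, P n 0) -> (forall n a x y, P n x -> P n y -> P n (a *: x + y)) ->
  P 0 tone -> (forall p n v t, homog p v -> P n t -> P (p + n) (tcons v t)) ->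
  forall n (x : tgr), homog n x -> P n x.
Proof.
move=> P0 PD P1 Pc n x /(homog_span (cS:=tgrade_thomog) (span:=thomog_span)) [s -> Hs].
rewrite big_seq; elim/big_ind: _ => // [y z Hy Hz|y /Hs [a [u [-> un]]]].
  by rewrite -[y]scale1r; apply: PD.
rewrite -[_ *: _]addr0; apply: PD => //; elim: u n un {Hs} => [|v u IH] n /=.
  by move=> ->.
move=> [p [vp un]]; rewrite -tcons_word; have := Pc p _ v _ vp (IH _ un).
by have -> : p + (n - p) = n by ring.
Qed.

Lemma tcons_homog p n (v : V) (t : tgr) :
  homog p v -> homog n t -> homog (p + n) (tcons v t : tgr).
Proof.
move=> vp /(homog_span (cS:=tgrade_thomog) (span:=thomog_span)) [s -> Hs].
rewrite bsumr; apply: (@homog_sum _ tgr) => y /Hs [a [u [-> un]]].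
rewrite bZr tcons_word; apply: (@homogZ _ tgr); apply: word_homogP => /=.
by exists p; split=> //; have -> : p + n - p = n by ring.
Qed.

Lemma parity_tone : parity tgr tone = tone.
Proof. by rewrite (parity_homog tone_homog) scale1r. Qed.

Lemma parity_tcons v (t : tgr) : parity tgr (tcons v t) = tcons (parity V v) (parity tgr t).
Proof.
elim/homog_ind: v => [|v w Hv Hw|p v vp]; first by rewrite linear0 !b0l linear0.
  by rewrite linearD !bDl linearD Hv Hw.
elim/homog_ind: t => [|s t Hs Ht|q t tq]; first by rewrite linear0 !b0r linear0.
  by rewrite linearD !bDr linearD Hs Ht.
rewrite (parity_homog vp) (parity_homog tq) (parity_homog (tcons_homog vp tq)).
by rewrite bZl bZr scalerA sgD.
Qed.

Definition rgrade n : {linear R -> R} := red_retr V \o tgrade n \o red_incl V.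
Definition rhomog n (y : R) := exists a u, y = a *: red_word u /\ word_homog n u.

Fact rgrade_rhomog n p y : rhomog n y -> rgrade p y = y *+ (p == n).
Proof.
move=> [a [u [-> un]]]; rewrite linearZ scalerMnr /rgrade /= red_incl_word.
case: u un => [|v u] un.
  by rewrite !linear0 (proj2 (red_word_multilin V)) mul0rn scaler0.
by rewrite (tgrade_word _ un) linearMn red_retr_word.
Qed.

Fact rhomog_span x : exists2 s : seq R,
  x = \sum_(y <- s) y & forall y, y \in s -> exists n, rhomog n y.
Proof.
rewrite -[x]red_inclK; have [s -> Hs] := thomog_span (red_incl V x).
exists [seq red_retr V y | y <- s]; first by rewrite linear_sum big_map.
move=> _ /mapP[z /Hs[n [b [u [-> un]]]] ->]; exists n, b, u.
by rewrite linearZ /= red_retr_word.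
Qed.

Definition rgr : gmod k := span_gmod rgrade_rhomog rhomog_span.

Lemma red_word_homogP n u : word_homog n u -> homog n (red_word u : rgr).
Proof. by move=> un; apply: span_homog; exists 1, u; rewrite scale1r. Qed.

Lemma rletter_homog n (v : V) : homog n v -> homog n (rletter v : rgr).
Proof.
by move=> vn; rewrite rletterE; apply: red_word_homogP; exists n; rewrite subrr.
Qed.

Lemma rtcons_homog p n (v : V) (r : rgr) :
  homog p v -> homog n r -> homog (p + n) (rtcons v r : rgr).
Proof.
move=> vp /(homog_span (cS:=rgrade_rhomog) (span:=rhomog_span)) [s -> Hs].
rewrite bsumr; apply: (@homog_sum _ rgr) => y /Hs [a [[|w u] [-> un]]].
  rewrite (proj2 (red_word_multilin V)) scaler0 b0r; exact: (@homog0 _ rgr).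
rewrite bZr rtcons_word //; apply: (@homogZ _ rgr); apply: red_word_homogP.
by exists p; split=> //; have -> : p + n - p = n by ring.
Qed.

Lemma rgr_homog_ind (P : int -> R -> Prop) :
  (forall n, P n 0) -> (forall n a x y, P n x -> P n y -> P n (a *: x + y)) ->
  (forall p v, homog p v -> P p (rletter v)) ->
  (forall p n v t, homog p v -> P n t -> P (p + n) (rtcons v t)) ->
  forall n (x : rgr), homog n x -> P n x.
Proof.
move=> P0 PD P1 Pc n x /(homog_span (cS:=rgrade_rhomog) (span:=rhomog_span)) [s -> Hs].
rewrite big_seq; elim/big_ind: _ => // [y z Hy Hz|y /Hs [a [u [-> un]]]].
  by rewrite -[y]scale1r; apply: PD.
rewrite -[_ *: _]addr0; apply: PD => //; elim: u n un {Hs} => [|v u IH] n.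
  by rewrite (proj2 (red_word_multilin V)).
case: u IH => [|w u] IH [p [vp un]].
  by rewrite -rletterE; have /eqP := un; rewrite subr_eq0 => /eqP ->; apply: P1.
rewrite -rtcons_word //; have := Pc p _ v _ vp (IH _ un).
by have -> : p + (n - p) = n by ring.
Qed.

Lemma parity_rletter v : parity rgr (rletter v) = rletter (parity V v).
Proof.
elim/homog_ind: v => [|v w Hv Hw|p v vp]; first by rewrite !linear0.
  by rewrite !linearD Hv Hw.
by rewrite (parity_homog vp) (parity_homog (rletter_homog vp)) linearZ.
Qed.

Lemma parity_rtcons v (t : rgr) : parity rgr (rtcons v t) = rtcons (parity V v) (parity rgr t).
Proof.
elim/homog_ind: v => [|v w Hv Hw|p v vp]; first by rewrite linear0 !b0l linear0.
  by rewrite linearD !bDl linearD Hv Hw.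
elim/homog_ind: t => [|s t Hs Ht|q t tq]; first by rewrite linear0 !b0r linear0.
  by rewrite linearD !bDr linearD Hs Ht.
rewrite (parity_homog vp) (parity_homog tq) (parity_homog (rtcons_homog vp tq)).
by rewrite bZl bZr scalerA sgD.
Qed.

End GradedTensorAlgebra.

(** * Convolution *)

Section TensorAssociativity.
Variables (k : comPzRingType) (U V W : lmodType k).

Program Definition bassoc : bilmap (tensor U V) W (tensor U (tensor V W)) :=
  Bilmap (bfun := fun t z => blift (bcomp idfun btens idfun (bapl btens z)) t) _ _.
Next Obligation. by move=> z a s t; rewrite linearP. Qed.
Next Obligation.
move=> t a z w; have [s ->] := tensor_sum t; rewrite /= !linear_sum -big_split.
apply: eq_bigr => -[x y] _; rewrite !blift_tens /= !baplE.
by rewrite !btensE !tensDr !tensZr.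
Qed.

Lemma tassocE t : tassoc t = blift bassoc t.
Proof.
rewrite -bliftE /tassoc; congr (tlift _ _); apply: funext => s; apply: funext => z /=.
rewrite -bliftE /=; congr (tlift _ _); apply: funext => x; apply: funext => y.
by rewrite baplE btensE.
Qed.

Lemma bassoc_tens x y z : bassoc (tens x y) z = tens x (tens y z).
Proof. by rewrite /= blift_tens /= baplE btensE. Qed.
End TensorAssociativity.

Section Convolution.
Variables (k : comPzRingType) (C : ga_cdg k).
Implicit Types M U V W : lmodType k.

(** The counit with values in the scalars, not in the graded module k. *)
Definition eps : {linear C -> k^o} := counit C.

Fact conv_linear U V W (m : bilmap U V W) (f : {linear C -> U}) (g : {linear C -> V}) :
  linear (blift m \o tmapl f g \o comul C).
Proof. by move=> a x y; rewrite linearP. Qed.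

(** The convolution of f and g along the product m. *)
Definition conv U V W (m : bilmap U V W) (f : {linear C -> U}) (g : {linear C -> V}) :
  {linear C -> W} := lin (conv_linear m f g).

Lemma conv_def U V W (m : bilmap U V W) f g x :
  conv m f g x = blift m (tmapl f g (comul C x)).
Proof. exact: linE. Qed.

Lemma convE U V W (m : bilmap U V W) f g x s :
  comul C x = \sum_(z <- s) tens z.1 z.2 -> conv m f g x = \sum_(z <- s) m (f z.1) (g z.2).
Proof.
move=> E; rewrite conv_def E !linear_sum; apply: eq_bigr => z _.
by rewrite tmapl_tens blift_tens.
Qed.

Lemma counit_sweedler x s : comul C x = \sum_(z <- s) tens z.1 z.2 ->
  \sum_(z <- s) eps z.1 *: z.2 = x /\ \sum_(z <- s) eps z.2 *: z.1 = x.
Proof.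
move=> E; pose l : bilmap C C C := bscale eps idfun; split.
  have := counitl x; rewrite E.
  have -> t : tlift (fun y z => (counit C y : k) *: z) t =
    blift (Bilmap (bil_r l) (bil_l l)) t by rewrite -bliftE.
  by rewrite linear_sum => <-; apply: eq_bigr => z _; rewrite blift_tens.
have := counitr x; rewrite E.
have -> t : tlift (fun y z => (counit C z : k) *: y) t = blift l t by rewrite -bliftE.
by rewrite linear_sum => <-; apply: eq_bigr => z _; rewrite blift_tens.
Qed.

Lemma eq_conv U V W (m : bilmap U V W) (f f' : {linear C -> U}) (g g' : {linear C -> V}) x :
  f =1 f' -> g =1 g' -> conv m f g x = conv m f' g' x.
Proof.
move=> ff gg; have [s E] := tensor_sum (comul C x); rewrite !(convE _ _ _ E).
by apply: eq_bigr => z _; rewrite ff gg.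
Qed.

Lemma conv_counitl U V W (m : bilmap U V W) (f : {linear C -> U}) g u x :
  (forall y, f y = eps y *: u) -> conv m f g x = m u (g x).
Proof.
move=> fu; have [s E] := tensor_sum (comul C x); rewrite (convE _ _ _ E).
have [<- _] := counit_sweedler E; rewrite linear_sum bsumr.
by apply: eq_bigr => z _; rewrite fu bZl linearZ bZr.
Qed.

(** Coassociativity: convolution is associative for any four products that
satisfy the associative law, not only for those of one algebra. *)
Lemma convA U V W P Q M (m1 : bilmap U V P) (m : bilmap P W M)
    (m2 : bilmap V W Q) (m' : bilmap U Q M) f g h x :
  (forall u v w, m (m1 u v) w = m' u (m2 v w)) ->
  conv m (conv m1 f g) h x = conv m' f (conv m2 g h) x.
Proof.
move=> mA; have := comulA x; rewrite !tmaplE tassocE.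
pose G := blift (bcomp idfun m' f (blift m2 \o tmapl g h)).
move/(congr1 G); have [s E] := tensor_sum (comul C x).
rewrite !(convE _ _ _ E) E !linear_sum /= => H.
rewrite [RHS](eq_bigr (fun z => G (tmapl idfun (comul C) (tens z.1 z.2)))); last first.
  by move=> z _; rewrite tmapl_tens /G blift_tens /= conv_def.
rewrite -{}H; apply: eq_bigr => z _.
rewrite tmapl_tens blift_tens; have [t Et] := tensor_sum (comul C z.1).
rewrite (convE _ _ _ Et) Et !(bsuml, linear_sum); apply: eq_bigr => w _.
by rewrite bassoc_tens /G blift_tens /= tmapl_tens blift_tens mA.
Qed.

Lemma conv_homog (U V W : gmod k) (m : bilmap U V W) (f : {linear C -> U})
    (g : {linear C -> V}) p q :
  (forall i j x y, homog i x -> homog j y -> homog (i + j) (m x y)) ->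
  degree p f -> degree q g -> degree (p + q) (conv m f g).
Proof.
move=> mh fp gq n x /comul_deg Hx; rewrite conv_def.
have H := tensor_homog_map fp gq Hx; rewrite -[n + (p + q)]addr0 addrA.
by apply: blift_homog H => i j a b ai bj; rewrite addr0; apply: mh.
Qed.

Lemma eps_parity x : eps (parity C x) = eps x.
Proof.
rewrite /eps -(parity_degree0 _ (counit_deg (g := C))).
by have := @parity_homog _ (gunit k) 0 (counit C x); rewrite scale1r; apply.
Qed.

Lemma comul_parity x : comul C (parity C x) = tmapl (parity C) (parity C) (comul C x).
Proof.
have := @homog_ext k C _ (comul C \o parity C) (tmapl (parity C) (parity C) \o comul C); apply.
move=> p {}x xp; rewrite /= (parity_homog xp) linearZ /=; have [s -> Hs] := comul_deg xp.
rewrite scaler_sumr linear_sum big_seq [RHS]big_seq; apply: eq_bigr => z /Hs [q [h1 h2]].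
rewrite tmapl_tens (parity_homog h1) (parity_homog h2) tensZl tensZr scalerA -sgD.
by have -> : q + (p - q) = p by ring.
Qed.

Lemma conv_parity U V W (m : bilmap U V W) f g x :
  conv m f g (parity C x) = conv m (f \o parity C) (g \o parity C) x.
Proof.
have [s E] := tensor_sum (comul C x); rewrite (convE _ _ _ E).
rewrite (@convE _ _ _ _ _ _ _ [seq (parity C z.1, parity C z.2) | z <- s]) ?big_map //.
by rewrite comul_parity E linear_sum; apply: eq_bigr => z _; rewrite tmapl_tens.
Qed.

Definition coderivation (D : {linear C -> C}) :=
  forall x, comul C (D x) = tmapl D idfun (comul C x) + tmapl (parity C) D (comul C x).

Lemma conv_coderivation D U V W (m : bilmap U V W) f g x : coderivation D ->
  conv m f g (D x) = conv m (f \o D) g x + conv m (f \o parity C) (g \o D) x.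
Proof.
move=> /(_ x) E; have [s Es] := tensor_sum (comul C x).
rewrite !(convE _ _ _ Es) conv_def E Es !linear_sum -!big_split !linear_sum.
apply: eq_bigr => z _; rewrite /= !tmapl_tens !linearD /= !tmapl_tens.
by rewrite !blift_tens.
Qed.

Lemma codiff_coderivation : coderivation (codiff C).
Proof.
by move=> x; rewrite codiff_comul tmaplE gtmapE; congr (_ + tmapl _ _ _);
  apply: linear_ext.
Qed.
End Convolution.

Section AlgebraConvolution.
Variables (k : comPzRingType) (C : ga_cdg k) (A : curved_dga k).

Fact amulb_sig : {b : bilmap A A A | forall x y, amul x y = b x y}.
Proof. by exists (Bilmap (@amul_linl k A) (@amul_linr k A)). Qed.
Definition amulb : bilmap A A A := sval amulb_sig.
Lemma amulbE x y : amul x y = amulb x y. Proof. exact: svalP amulb_sig x y. Qed.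

Lemma amulbA x y z : amulb (amulb x y) z = amulb x (amulb y z).
Proof. by rewrite -!amulbE amulA. Qed.

Definition derivation (D : {linear A -> A}) :=
  forall x y, D (amulb x y) = amulb (D x) y + amulb (parity A x) (D y).

Lemma adiff_derivation : derivation (adiff A).
Proof.
move=> x y; elim/homog_ind: x => [|x x' Hx Hx'|p x xp].
- by rewrite !(b0l, linear0) addr0.
- by rewrite !(bDl, linearD) Hx Hx' addrACA.
by rewrite -amulbE (adiff_mul _ xp) (parity_homog xp) bZl !amulbE.
Qed.

Lemma derivation_conv D f g (x : C) : derivation D ->
  D (conv amulb f g x) = conv amulb (D \o f) g x + conv amulb (parity A \o f) (D \o g) x.
Proof.
move=> DD; have [s E] := tensor_sum (comul C x).
rewrite !(convE _ _ _ E) linear_sum -big_split; apply: eq_bigr => z _; exact: DD.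
Qed.

Lemma gtmap_conv (f g : {linear C -> A}) x :
  tlift (@amul k A) (gtmap 1 f g (comul C x)) = conv amulb (f \o parity C) g x.
Proof.
rewrite gtmapE conv_def -bliftE; congr (tlift _ _).
by apply: funext => y; apply: funext => z; rewrite amulbE.
Qed.
End AlgebraConvolution.

(** * The tensor coalgebra *)

Section TensorCoalgebra.
Variables (k : comPzRingType) (V : gmod k).
Local Notation T := (tensor_alg V).
Local Notation TT := (tensor T T).

Fact teta_sig : {h : {linear T -> k^o} | h tone = 1 /\ forall v t, h (tcons v t) = 0}.
Proof.
apply: cid; have [h [h1 hc]] := talg_rec (1 : k^o) (bzero V T k^o) (bzero V k^o k^o).
by exists h; split=> // v t; rewrite hc addr0.
Qed.
Definition teta : {linear T -> k^o} := sval teta_sig.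
Lemma teta1 : teta tone = 1. Proof. by have [] := svalP teta_sig. Qed.
Lemma teta_cons v t : teta (tcons v t) = 0. Proof. by have [_] := svalP teta_sig. Qed.

Fact tletter_sig : {h : {linear T -> V} | h tone = 0 /\
  forall v t, h (tcons v t) = teta t *: v}.
Proof.
apply: cid; have [h [h1 hc]] := talg_rec (0 : V) (bscale teta idfun) (bzero V V V).
by exists h; split=> // v t; rewrite hc addr0.
Qed.
Definition tletter : {linear T -> V} := sval tletter_sig.
Lemma tletter1 : tletter tone = 0. Proof. by have [] := svalP tletter_sig. Qed.
Lemma tletter_cons v t : tletter (tcons v t) = teta t *: v.
Proof. by have [_] := svalP tletter_sig. Qed.

Fact lact_linl (t : TT) : linear (fun v : V => tmapl (bapr tcons v) idfun t).
Proof.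
move=> a v w; have [s ->] := tensor_sum t; rewrite /= !linear_sum -big_split.
by apply: eq_bigr => z _; rewrite /= !tmapl_tens !baprE bDl bZl tensDl tensZl.
Qed.
Fact lact_linr (v : V) : linear (tmapl (bapr tcons v) (idfun : {linear T -> T})).
Proof. by move=> a x y; rewrite linearP. Qed.
Fact lact_sig : {b : bilmap V TT TT | forall v t, b v t = tmapl (bapr tcons v) idfun t}.
Proof. by exists (Bilmap lact_linl lact_linr). Qed.
(** Prepends a letter to the left tensor factor. *)
Definition lact : bilmap V TT TT := sval lact_sig.
Lemma lact_tens v x y : lact v (tens x y) = tens (tcons v x) y.
Proof. by rewrite /lact (svalP lact_sig) tmapl_tens baprE. Qed.

(** Deconcatenation either cuts before the first letter or after it. *)
Fact tdelta_sig : {h : {linear T -> TT} | h tone = tens tone tone /\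
  forall v t, h (tcons v t) = tens tone (tcons v t) + lact v (h t)}.
Proof.
apply: cid; have [h [h1 hc]] :=
  talg_rec (tens tone tone) (bcomp (bapr (btens : bilmap T T TT) tone) tcons idfun idfun) lact.
by exists h; split=> // v t; rewrite hc /= baprE.
Qed.
Definition tdelta : {linear T -> TT} := sval tdelta_sig.
Lemma tdelta1 : tdelta tone = tens tone tone.
Proof. by have [] := svalP tdelta_sig. Qed.
Lemma tdelta_cons v t : tdelta (tcons v t) = tens tone (tcons v t) + lact v (tdelta t).
Proof. by have [_] := svalP tdelta_sig. Qed.

Lemma tdelta_word u :
  tdelta (word u) = \sum_(i < (size u).+1) tens (word (take i u)) (word (drop i u)).
Proof.
elim: u => [|v u IH]; first by rewrite tdelta1 big_ord_recl big_ord0 addr0.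
rewrite -tcons_word tdelta_cons IH [RHS]big_ord_recl /= tcons_word bsumr.
by congr (_ + _); apply: eq_bigr => i _; rewrite lact_tens tcons_word.
Qed.

Fact tdeltaA x : tassoc (tmap tdelta idfun (tdelta x)) = tmap idfun tdelta (tdelta x).
Proof.
rewrite !tmaplE tassocE.
have BL v (d : TT) (y : T) :
    blift (bassoc _ _ _) (tens (lact v d) y) =
    tmapl (bapr tcons v) idfun (blift (bassoc _ _ _) (tens d y)).
  have [s ->] := tensor_sum d; rewrite bsumr !blift_tens !bsuml linear_sum.
  apply: eq_bigr => z _.
  by rewrite lact_tens !bassoc_tens tmapl_tens baprE.
elim/talg_ind: x => [a x y Hx Hy||v t IH].
- by rewrite !linearP Hx Hy.
- by rewrite tdelta1 !tmapl_tens tdelta1 blift_tens bassoc_tens.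
have [s E] := tensor_sum (tdelta t).
pose L := tmapl (bapr tcons v) (idfun : {linear TT -> TT}).
move/(congr1 L): IH; rewrite tdelta_cons !linearD !tmapl_tens tdelta1 tdelta_cons tensDr.
rewrite blift_tens bassoc_tens -addrA => IH; congr (_ + _).
have -> : tens (tone : T) (lact v (tdelta t)) = \sum_(z <- s) tens tone (tens (tcons v z.1) z.2).
  rewrite E bsumr tens_sumr; apply: eq_bigr => z _.
  by rewrite lact_tens.
have -> : tmapl idfun tdelta (lact v (tdelta t)) = L (tmapl idfun tdelta (tdelta t)).
  rewrite E bsumr !linear_sum; apply: eq_bigr => z _.
  by rewrite lact_tens /L !tmapl_tens /= baprE.
rewrite -{}IH E bsumr !linear_sum -big_split; apply: eq_bigr => z _.
rewrite /= lact_tens !tmapl_tens /L tdelta_cons tensDl linearD BL; congr (_ + _).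
by rewrite blift_tens bassoc_tens.
Qed.

Fact teta_l x : tlift (fun y z => (teta y : k) *: z) (tdelta x) = x.
Proof.
pose l : bilmap T T T := bscale teta idfun.
pose m : bilmap T T T := Bilmap (bil_r l) (bil_l l).
rewrite -[LHS]/(tlift m _) bliftE.
elim/talg_ind: x => [a x y Hx Hy||v t IH].
- by rewrite !linearP Hx Hy.
- by rewrite tdelta1 blift_tens /= teta1 scale1r.
rewrite tdelta_cons linearD blift_tens /= teta1 scale1r.
have [s ->] := tensor_sum (tdelta t); rewrite bsumr linear_sum big1 ?addr0 // => z _.
by rewrite lact_tens blift_tens /= teta_cons scale0r.
Qed.

Fact teta_r x : tlift (fun y z => (teta z : k) *: y) (tdelta x) = x.
Proof.
pose l : bilmap T T T := bscale teta idfun.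
rewrite -[LHS]/(tlift l _) bliftE.
elim/talg_ind: x => [a x y Hx Hy||v t IH].
- by rewrite !linearP Hx Hy.
- by rewrite tdelta1 blift_tens /= teta1 scale1r.
rewrite tdelta_cons linearD blift_tens /= teta_cons scale0r add0r.
rewrite -[in RHS]IH; have [s ->] := tensor_sum (tdelta t); rewrite !linear_sum !bsumr linear_sum.
apply: eq_bigr => z _.
by rewrite lact_tens !blift_tens /= bZr.
Qed.

Local Notation G := (tgr V).

Fact tdelta_deg n (x : G) : homog n x -> tensor_homog n (tdelta x : tensor G G).
Proof.
move=> xn; suff [] : homog n x /\ tensor_homog n (tdelta x : tensor G G) by [].
move: n x xn; apply: tgr_homog_ind.
- by move=> n; rewrite linear0; split; [exact: homog0 | exact: tensor_homog0].
- move=> n a x y [x1 x2] [y1 y2]; split; first exact: homogP.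
  by rewrite linearP; apply: tensor_homogD => //; apply: tensor_homogZ.
- split; first exact: tone_homog.
  rewrite tdelta1; exact: (tensor_homog_tens (tone_homog V) (tone_homog V)).
move=> p n v t vp [tn [s E Hs]]; have vt := tcons_homog vp tn; split=> //.
rewrite tdelta_cons; apply: tensor_homogD.
  by rewrite -[p + n]add0r; apply: (tensor_homog_tens (tone_homog V) vt).
rewrite E bsumr big_seq; elim/big_ind: _ => [|x y|z /Hs [q [h1 h2]]].
- exact: tensor_homog0.
- exact: tensor_homogD.
rewrite lact_tens; have -> : p + n = (p + q) + (n - q) by ring.
exact: (tensor_homog_tens (tcons_homog vp h1) h2).
Qed.

Fact teta_deg : degree 0 (teta : G -> gunit k).
Proof.
apply: tgr_homog_ind => [n|n a x y Hx Hy||p n v t _ _].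
- by rewrite linear0; apply: homog0.
- by rewrite linearP; apply: homogP.
- by rewrite teta1.
by rewrite teta_cons; apply: homog0.
Qed.

Fact gunit_homog n (a : gunit k) : homog n a -> n = 0 \/ a = 0.
Proof.
rewrite /homog /=; case: eqP => [->|_]; first by left.
by rewrite mulr0n => <-; right.
Qed.

Lemma tletter_deg : degree 0 (tletter : G -> V).
Proof.
move=> n x; rewrite addr0; move: n x.
suff H n (x : G) : homog n x -> homog n (tletter x) /\ homog n (teta x : gunit k).
  by move=> n x /H [].
move: n x; apply: tgr_homog_ind => [n|n a x y [Hx Hx'] [Hy Hy']||p n v t vp [_ tn]].
- by rewrite !linear0; split; apply: homog0.
- by rewrite !linearP; split; apply: homogP.
- by rewrite teta1 tletter1; split=> //; apply: homog0.
rewrite tletter_cons teta_cons; split; last exact: homog0.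
case: (gunit_homog tn) => ->; first by rewrite addr0; apply: homogZ.
by rewrite scale0r; apply: homog0.
Qed.

Fact taug_linear : linear (fun a : k^o => (a : k) *: tone : T).
Proof. by move=> a x y; rewrite scalerDl scalerA. Qed.
Definition taug : {linear k^o -> T} := lin taug_linear.
Lemma taugE a : taug a = (a : k) *: tone. Proof. exact: linE. Qed.
Fact taug_deg : degree 0 (taug : gunit k -> G).
Proof.
move=> n a /gunit_homog an; rewrite taugE addr0.
by case: an => ->; [exact/homogZ/tone_homog | rewrite scale0r; apply: homog0].
Qed.

Section WithCodifferential.
Variable D : {linear G -> G}.
Hypothesis D_deg : degree 1 D.
Hypothesis D_sqr : forall x, D (D x) = 0.
Hypothesis D_co : forall x,
  tdelta (D x) = tmapl D idfun (tdelta x) + tmapl (parity G) D (tdelta x).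
Hypothesis D_eta : forall x, teta (D x) = 0.

Fact taug_comul : tdelta (taug (1 : k)) = tens (taug (1 : k)) (taug (1 : k)).
Proof. by rewrite taugE scale1r tdelta1. Qed.
Fact taug_counit : teta (taug (1 : k)) = (1 : k).
Proof. by rewrite taugE scale1r teta1. Qed.
Fact D_comul x : tdelta (D x) =
  tmap D idfun (tdelta x) + @gtmap k G G _ _ 1 idfun D (tdelta x).
Proof.
rewrite D_co tmaplE (@gtmapE k G G G G idfun D); congr (_ + tmapl _ _ _).
exact: linear_ext.
Qed.

Definition tcoalg : ga_cdg k :=
  @GaCdg k G tdelta teta taug D tdelta_deg tdeltaA teta_deg teta_l teta_r
    taug_deg taug_comul taug_counit D_deg D_sqr D_comul D_eta.
End WithCodifferential.

End TensorCoalgebra.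
Arguments teta {k} V.
Arguments tletter {k} V.
Arguments taug {k} V.
Arguments lact {k} V.
Arguments tdelta {k} V.

(** * Cofreeness of the tensor coalgebra *)

Lemma eventually_all (I : eqType) (P : I -> nat -> Prop) (s : seq I) :
  (forall z, exists N, forall n, (N <= n)%N -> P z n) ->
  exists N, forall n, (N <= n)%N -> forall z, z \in s -> P z n.
Proof.
move=> H; elim: s => [|z s [N HN]]; first by exists 0.
have [M HM] := H z; exists (maxn M N) => n; rewrite geq_max => /andP[Mn Nn] w.
by rewrite inE => /orP[/eqP->|]; [exact: HM | exact: HN].
Qed.

Section LocallyFiniteSums.
Variables (k : comPzRingType) (U M : lmodType k) (F : nat -> {linear U -> M}).
Hypothesis F_fin : forall x, exists N, forall n, (N <= n)%N -> F n x = 0.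

Lemma locally_finite_sum : exists f : {linear U -> M},
  forall x, exists N, forall n, (N <= n)%N -> f x = \sum_(i < n) F i x.
Proof.
have H x : exists v, exists N, forall n, (N <= n)%N -> v = \sum_(i < n) F i x.
  have [N HN] := F_fin x; exists (\sum_(i < N) F i x), N => n Nn.
  rewrite -(big_mkord xpredT (F^~ x)) -[RHS](big_mkord xpredT (F^~ x)).
  rewrite [RHS](@big_cat_nat _ _ _ N) //= [X in _ + X]big_nat_cond [X in _ + X]big1 ?addr0 //.
  by move=> i /andP[/andP[/HN]].
have [f Hf] := choice H.
have fL : linear f.
  move=> a x y; have [n1 H1] := Hf x; have [n2 H2] := Hf y.
  have [n3 H3] := Hf (a *: x + y); set m := maxn n1 (maxn n2 n3).
  rewrite (H1 m) ?(H2 m) ?(H3 m) ?leq_max ?leqnn ?orbT // scaler_sumr -big_split.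
  by apply: eq_bigr => i _; rewrite linearP.
by exists (lin fL) => x; have [n Hn] := Hf x; exists n => m nm; rewrite linE; apply: Hn.
Qed.
End LocallyFiniteSums.

Section ReducedIteration.
Variables (k : comPzRingType) (C : ga_cdg k).
Local Notation rC := (red_coalg C).

Definition rpr : {linear C -> rC} := lin (coker_pr_linear (augm C)).
Lemma rprE x : red_pr x = rpr x. Proof. exact/esym/linE. Qed.

Lemma rpr_surj (x : rC) : exists y, x = rpr y.
Proof. by have [y ->] := coker_pr_surj x; exists y; rewrite -rprE. Qed.

Lemma rpr_augm a : rpr (augm C a) = 0.
Proof. by rewrite -rprE; have [_ ] := coker_pr_adm (augm C); apply. Qed.

Lemma red_lift (M : lmodType k) (f : {linear C -> M}) : (forall a, f (augm C a) = 0) ->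
  exists g : {linear rC -> M}, forall x, g (rpr x) = f x.
Proof.
by move=> /(@coker_lift _ _ _ _ (augm C)) [g Hg]; exists g => x; rewrite -rprE -Hg.
Qed.

Lemma augm_scale a : augm C a = (a : k) *: augm C (1 : k).
Proof. by rewrite -linearZ; congr (augm C _); rewrite -[RHS]/(a * 1) mulr1. Qed.

Lemma gcomp_rpr p x : gcomp rC p (rpr x) = rpr (gcomp C p x).
Proof. by rewrite -!rprE; exact: (gcoker_pr (@augm_deg k C)). Qed.

Lemma rpr_deg : degree 0 (rpr : C -> rC).
Proof.
by move=> p x xp; rewrite addr0 /homog gcomp_rpr xp.
Qed.

Lemma rpr_homog_surj p (x : rC) : homog p x -> exists2 y, homog p y & x = rpr y.
Proof.
move=> <-; have [y ->] := rpr_surj x; exists (gcomp C p y); first exact: homog_gcomp.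
by rewrite gcomp_rpr.
Qed.

Lemma red_comul_lin : exists d : {linear rC -> tensor rC rC},
  (forall x, d x = red_comul x) /\ forall x, d (rpr x) = tmapl rpr rpr (comul C x).
Proof.
have E x : red_comul (rpr x) = tmapl rpr rpr (comul C x).
  rewrite -rprE red_comul_pr -tmaplE; congr (tmap _ _ _); apply: funext => y;
  exact: rprE.
have [|d Hd] := @red_lift _ (tmapl rpr rpr \o comul C).
  move=> a; rewrite augm_scale linearZ /= augm_comul.
  by rewrite tmapl_tens !rpr_augm tens0l scaler0.
exists d; split=> x; last exact: Hd.
by have [y ->] := rpr_surj x; rewrite Hd E.
Qed.

Lemma red_comul_iter_lin n :
  exists d : {linear rC -> tpow rC n}, forall x, d x = red_comul_iter n x.
Proof.
elim: n => [|n [d Hd]]; first by exists idfun.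
have [e [He _]] := red_comul_lin; exists (tmapl idfun d \o e) => x /=.
by rewrite He -tmaplE; congr (tmap _ _ _); apply: funext.
Qed.

(** Each iterated comultiplication factors through the preceding one, by applying
the comultiplication to the last tensor factor. *)
Lemma red_comul_iter_stable n m (x : rC) :
  (n <= m)%N -> red_comul_iter n x = 0 -> red_comul_iter m x = 0.
Proof.
have step i : exists h : {linear tpow rC i -> tpow rC i.+1},
    forall x : rC, red_comul_iter i.+1 x = h (red_comul_iter i x).
  elim: i => [|i [h Hh]].
    have [e [He _]] := red_comul_lin; exists e => y /=; rewrite He.
    exact: tmap_id.
  have [d Hd] := red_comul_iter_lin i.
  exists (tmapl idfun h) => y; have [e [He _]] := red_comul_lin.
  rewrite [LHS]/= [X in _ = _ X]/=.
  have -> : @red_comul_iter k C i = d by apply: funext => z; rewrite Hd.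
  rewrite -tmaplE -tmap_comp; congr (tmap _ _ _); apply: funext => z /=.
  by rewrite Hd -Hh /=; congr (tmap _ _ _); apply: funext.
move=> /subnKC <-; elim: (m - n)%N => [|i IH] H; first by rewrite addn0.
by have [h Hh] := step (n + i)%N; rewrite addnS Hh IH // linear0.
Qed.

(** Maps that kill the augmentation are convolved through the reduced
comultiplication alone, and by induction every E n is such a map. *)
Lemma conv_iter_factor (V P : lmodType k) (m : bilmap V P P) (tau : {linear C -> V})
    (E : nat -> {linear C -> P}) :
  (forall a, tau (augm C a) = 0) -> (forall a, E 0 (augm C a) = 0) ->
  (forall n x, E n.+1 x = conv m tau (E n) x) ->
  forall n, exists w : {linear tpow rC n -> P}, forall x, E n x = w (red_comul_iter n (rpr x)).
Proof.
move=> tau0 E0 ES; have [t Ht] := red_lift tau0.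
elim=> [|n [w Hw]]; first by have [w Hw] := red_lift E0; exists w => x; rewrite Hw.
exists (blift (bcomp idfun m t w)) => x; rewrite ES [red_comul_iter _ _]/=.
have [e [He Hr]] := red_comul_lin; have [d Hd] := red_comul_iter_lin n.
have -> : @red_comul_iter k C n = d by apply: funext => z; rewrite Hd.
rewrite -He Hr tmaplE; have [s Es] := tensor_sum (comul C x).
rewrite (convE _ _ _ Es) Es !linear_sum; apply: eq_bigr => z _.
by rewrite !tmapl_tens blift_tens /= Hw Hd Ht.
Qed.

(** Uniqueness of solutions of fixed point equations: a solution of the
homogeneous equation factors through every iterated reduced comultiplication,
and on each element one of these vanishes. *)
Lemma conv_fixpoint0 (V P : lmodType k) (m : bilmap V P P) (tau : {linear C -> V})
    (E : {linear C -> P}) : cocomplete C ->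
  (forall a, tau (augm C a) = 0) -> (forall x, E x = conv m tau E x) -> E =1 \0.
Proof.
move=> cC tau0 HE x; have E0 a : E (augm C a) = 0.
  rewrite HE conv_def augm_scale linearZ /= augm_comul linearZ linearZ /=.
  by rewrite tmapl_tens tau0 blift_tens b0l scaler0.
have [n Hn] := cC (rpr x).
have [w ->] := conv_iter_factor (E := fun _ => E) tau0 E0 (fun _ => HE) n.
by rewrite Hn linear0.
Qed.
End ReducedIteration.

Section CofreeMap.
Variables (k : comPzRingType) (C : ga_cdg k) (V : gmod k).
Local Notation T := (tensor_alg V).
Hypothesis cC : cocomplete C.
Variable tau : {linear C -> V}.
Hypothesis tau_augm : forall a, tau (augm C a) = 0.
Hypothesis tau_deg : degree 0 tau.

(** The part of the coalgebra map that takes values in words of length n. *)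
Fixpoint cofree_comp n : {linear C -> T} :=
  if n is n'.+1 then conv tcons tau (cofree_comp n') else taug V \o eps C.

Fact cofree_comp_nil x : exists N, forall n, (N <= n)%N -> cofree_comp n x = 0.
Proof.
have [N HN] := cC (rpr C x); exists N.+1 => -[//|n] /= Nn.
have H a : cofree_comp 1 (augm C a) = 0.
  rewrite conv_def augm_scale linearZ /= augm_comul linearZ linearZ /=.
  by rewrite tmapl_tens tau_augm blift_tens b0l scaler0.
have [w Hw] := conv_iter_factor (E := fun n => cofree_comp n.+1)
  tau_augm H (fun n x => erefl) n.
by rewrite [LHS]Hw (@red_comul_iter_stable _ _ N) // linear0.
Qed.

(** The sum over all word lengths is locally finite by cocompleteness, and
shifting the length by one shows that it solves the fixed point equation. *)
Lemma cofree_map_exists : exists f : {linear C -> T},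
  degree 0 (f : C -> tgr V) /\ forall x, f x = taug V (eps C x) + conv tcons tau f x.
Proof.
have [f Hf] := locally_finite_sum cofree_comp_nil; exists f; split.
  move=> p x xp; have [N HN] := Hf x; rewrite (HN N) //.
  apply: (@homog_sum _ (tgr V)) => i _.
  elim: {i}(nat_of_ord i) p x xp {HN} => [|i IH] p x xp /=.
    by have := taug_deg V (counit_deg xp); rewrite !addr0.
  rewrite -[p + 0]addr0; have := @conv_homog k C V (tgr V) (tgr V) tcons tau (cofree_comp i) 0 0.
  by rewrite addr0 addr0; apply=> // *; exact: tcons_homog.
move=> x; have [N HN] := Hf x; have [s E] := tensor_sum (comul C x).
have [M HM] := eventually_all [seq z.2 | z <- s] Hf.
rewrite (HN (maxn N M).+1) ?leqW ?leq_maxl // big_ord_recl /=; congr (_ + _).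
rewrite (convE _ _ _ E) (eq_bigr _ (fun i _ => convE _ _ _ E)) exchange_big /=.
rewrite big_seq [RHS]big_seq; apply: eq_bigr => z zs.
by rewrite -bsumr -(HM _ (leq_maxr N M)) // map_f.
Qed.

Lemma teta_cofree (f : {linear C -> T}) :
  (forall x, f x = taug V (eps C x) + conv tcons tau f x) -> forall x, teta V (f x) = eps C x.
Proof.
move=> Hf x; rewrite Hf linearD /= taugE linearZ /= teta1.
have [s E] := tensor_sum (comul C x); rewrite (convE _ _ _ E) linear_sum.
rewrite big1 => [|z _]; last by rewrite /= teta_cons.
by rewrite addr0; apply: mulr1.
Qed.

(** The fixed point is comultiplicative because deconcatenation of it solves
the same kind of equation as its tensor square. *)
Lemma cofree_comul (f : {linear C -> T}) :
  (forall x, f x = taug V (eps C x) + conv tcons tau f x) ->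
  forall x, tdelta V (f x) = conv btens f f x.
Proof.
move=> Hf x.
pose E : {linear C -> tensor T T} :=
  GRing.add_fun (tdelta V \o f) (\- conv btens f f).
suff : E x = 0 by rewrite /E /= => /eqP; rewrite subr_eq0 => /eqP.
apply: (conv_fixpoint0 (m := lact V) (tau := tau)) => // {}x.
have [s Es] := tensor_sum (comul C x).
have cvf : conv btens f f x = tens tone (f x) + conv (lact V) tau (conv btens f f) x.
  rewrite -(@convA _ _ _ _ _ _ _ _ tcons btens); last by move=> *; rewrite lact_tens.
  have -> : tens tone (f x) = conv btens (taug V \o eps C) f x.
    have H y : (taug V \o eps C) y = (eps C y : k) *: tone by rewrite /= taugE.
    by rewrite (conv_counitl btens f x H).
  rewrite !(convE _ _ _ Es) -big_split; apply: eq_bigr => z _.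
  by rewrite [f z.1]Hf /= tensDl.
have dlt : tdelta V (f x) = tens tone (f x) + conv (lact V) tau (tdelta V \o f) x.
  rewrite Hf linearD tensDr (convE _ _ _ Es) linear_sum (convE _ _ _ Es) tens_sumr.
  rewrite -addrA -big_split /= taugE tensZr linearZ /= tdelta1; congr (_ + _).
  by apply: eq_bigr => z _; rewrite tdelta_cons.
rewrite /E /= cvf dlt opprD addrACA subrr add0r !(convE _ _ _ Es) -sumrB.
by apply: eq_bigr => z _; rewrite /= bDr bNr.
Qed.

Lemma cofree_augm (f : {linear C -> T}) :
  (forall x, f x = taug V (eps C x) + conv tcons tau f x) ->
  forall a, f (augm C a) = taug V a.
Proof.
move=> Hf a; rewrite augm_scale linearZ /= Hf conv_def augm_comul tmapl_tens tau_augm.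
by rewrite blift_tens b0l addr0 /eps augm_counit !taugE scale1r.
Qed.

Lemma tletter_cofree (f : {linear C -> T}) :
  (forall x, f x = taug V (eps C x) + conv tcons tau f x) -> forall x, tletter V (f x) = tau x.
Proof.
move=> Hf x; rewrite Hf linearD /= taugE linearZ /= tletter1 scaler0 add0r.
have [s E] := tensor_sum (comul C x); rewrite (convE _ _ _ E) linear_sum.
have [_ <-] := counit_sweedler E; rewrite linear_sum; apply: eq_bigr => z _.
by rewrite /= tletter_cons (teta_cofree Hf) linearZ.
Qed.

End CofreeMap.

(** * Rigidity of maps into the tensor coalgebra *)

Section Rigidity.
Variables (k : comPzRingType) (V : gmod k).
Local Notation T := (tensor_alg V).
Local Notation G := (tgr V).

Let null : {linear G -> G} := GRing.null_fun _.
Fact null_deg : degree 1 null.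
Proof. by move=> p x _; apply: homog0. Qed.
Fact null_co x : tdelta V (null x) =
  tmapl null idfun (tdelta V x) + tmapl (parity G) null (tdelta V x).
Proof.
have [s ->] := tensor_sum (tdelta V x); rewrite linear0 !linear_sum -big_split big1 // => z _.
by rewrite /= !tmapl_tens /= tens0l tens0r addr0.
Qed.
Fact null_eta x : teta V (null x) = 0.
Proof. by rewrite linear0. Qed.

(* The tensor coalgebra with zero codifferential, for access to convolution. *)
Definition tcoalg0 : ga_cdg k := tcoalg null_deg (fun x => erefl) null_co null_eta.

(* For the letter projection, the components of the cofree map are the projections
   onto the words of length n. *)
Let P n : {linear T -> T} := @cofree_comp k tcoalg0 V (tletter V) n.

Fact tpart1 n : P n tone = tone *+ (n == 0)%N.
Proof.
case: n => [|n]; rewrite /P /=; first by rewrite taugE /eps /= teta1 scale1r.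
by rewrite conv_def /= tdelta1 tmapl_tens tletter1 blift_tens b0l.
Qed.

Fact tpart_cons n v t : P n (tcons v t) = if n is n'.+1 then tcons v (P n' t) else 0.
Proof.
case: n => [|n]; rewrite /P /=; first by rewrite taugE /eps /= teta_cons scale0r.
rewrite conv_def /= tdelta_cons linearD tmapl_tens tletter1 linearD /= blift_tens b0l add0r.
have [s E] := tensor_sum (tdelta V t).
rewrite -[in RHS](proj1 (@counit_sweedler k tcoalg0 t s E)) E bsumr !linear_sum bsumr.
apply: eq_bigr => z _.
by rewrite lact_tens tmapl_tens tletter_cons blift_tens bZl linearZ bZr.
Qed.

Fact tpart_sum z : exists N, forall n, (N <= n)%N -> \sum_(i < n) P i z = z.
Proof.
elim/talg_ind: z => [a x y [N HN] [M HM]||v t [N HN]].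
- exists (maxn N M) => n; rewrite geq_max => /andP[/HN Hx /HM Hy].
  rewrite -[in RHS]Hx -[in RHS]Hy.
  by rewrite scaler_sumr -big_split; apply: eq_bigr => i _; rewrite linearP.
- exists 1 => -[//|n] _; rewrite big_ord_recl tpart1 big1 ?addr0 // => i _.
  by rewrite tpart1.
exists N.+1 => -[//|n] Nn; rewrite big_ord_recl tpart_cons add0r.
by rewrite -[in RHS](HN n Nn) bsumr; apply: eq_bigr => i _; rewrite tpart_cons.
Qed.

(** The component of d of word length n + 1 is read off, after one deconcatenation,
from its letter component and its component of length n, so all of them vanish.
The hypothesis covers differences of coalgebra maps, coderivations along a
coalgebra map, and squares of odd coderivations. *)
Lemma skew_comul_eq0 (C : ga_cdg k) (d f g : {linear C -> T}) :
  (forall x, tdelta V (d x) = conv btens d f x + conv btens g d x) ->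
  (forall x, teta V (d x) = 0) -> (forall x, tletter V (d x) = 0) -> d =1 \0.
Proof.
move=> dd d0 d1 x; have [N HN] := tpart_sum (d x); rewrite -(HN N) // big1 // => i _.
elim: {i}(nat_of_ord i) x {HN} => [|n IH] x; rewrite /P /=.
  by rewrite taugE /eps /= d0 scale0r.
rewrite conv_def /= dd; have [s E] := tensor_sum (comul C x).
rewrite !(convE _ _ _ E) -big_split !linear_sum big1 // => z _ /=.
rewrite !linearD /= !tmapl_tens !blift_tens d1 b0l add0r.
by have := IH z.2; rewrite /P => ->; rewrite b0r.
Qed.
End Rigidity.

(** * The Maurer-Cartan equation and squares *)

Section MaurerCartan.
Variables (k : comPzRingType) (C : ga_cdg k) (A : curved_dga k).
Variables (D : {linear C -> C}) (d : {linear A -> A}) (c : A) (tau : {linear C -> A}).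
Hypothesis D_co : coderivation D.
Hypothesis D_deg : degree 1 D.
Hypothesis D_eps : forall x, eps C (D x) = 0.
Hypothesis d_der : derivation d.
Hypothesis d_c : d c = 0.
Hypothesis tau_deg : degree 1 tau.
Hypothesis tau_mc : forall x, tau (D x) =
  - ((eps C x : k) *: c + d (tau x) + conv (amulb A) (tau \o parity C) tau x).

Local Notation m := (amulb A).

(** Differentiating the Maurer-Cartan equation: the square of the derivation
minus the commutator with the curvature corresponds, under tau, to the square
of the coderivation. The cubic terms cancel by coassociativity. *)
Lemma mc_square x : d (d (tau x)) = tau (D (D x)) + (m c (tau x) - m (tau x) c).
Proof.
have kk y : parity A (tau (parity C y)) = - tau y by rewrite (parity_degree1 _ tau_deg) parityK.
have dconv : d (conv m (tau \o parity C) tau x) =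
    conv m (d \o tau \o parity C) tau x - conv m tau (d \o tau) x.
  rewrite (derivation_conv _ _ _ d_der); congr (_ + _); first exact: eq_conv.
  have [s E] := tensor_sum (comul C x); rewrite !(convE _ _ _ E) -sumrN.
  by apply: eq_bigr => z _; rewrite /= kk bNl.
have Dconv : conv m (tau \o parity C) tau (D x) =
    - conv m (tau \o D \o parity C) tau x + conv m tau (tau \o D) x.
  rewrite (conv_coderivation _ _ _ _ D_co).
  congr (_ + _); last by apply: eq_conv => z //=; rewrite parityK.
  have [s E] := tensor_sum (comul C x); rewrite !(convE _ _ _ E) -sumrN.
  by apply: eq_bigr => z _; rewrite /= (parity_degree1 _ D_deg) linearN bNl.
have tau2_parity y : conv m (tau \o parity C) tau (parity C y) = conv m tau (tau \o parity C) y.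
  by rewrite conv_parity; apply: eq_conv => z; rewrite /= ?parityK.
have S1 : conv m (tau \o D \o parity C) tau x = - (m c (tau x) +
    conv m (d \o tau \o parity C) tau x + conv m (conv m tau (tau \o parity C)) tau x).
  have [s E] := tensor_sum (comul C x).
  rewrite -[in m c _](proj1 (counit_sweedler E)) !(convE _ _ _ E) linear_sum bsumr.
  rewrite -!big_split -sumrN; apply: eq_bigr => z _ /=.
  by rewrite tau_mc tau2_parity eps_parity bNl !bDl bZl linearZ bZr.
have S2 : conv m tau (tau \o D) x = - (m (tau x) c +
    conv m tau (d \o tau) x + conv m tau (conv m (tau \o parity C) tau) x).
  have [s E] := tensor_sum (comul C x).
  rewrite -[in m _ c](proj2 (counit_sweedler E)) !(convE _ _ _ E) linear_sum bsuml.
  rewrite -!big_split -sumrN; apply: eq_bigr => z _ /=.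
  by rewrite tau_mc bNr !bDr bZr linearZ bZl.
have A3 := @convA k C _ _ _ _ _ _ m m m m tau (tau \o parity C) tau x (@amulbA k A).
have dtD : d (tau (D x)) =
    - (d (d (tau x)) + (conv m (d \o tau \o parity C) tau x - conv m tau (d \o tau) x)).
  by rewrite tau_mc linearN !linearD linearZ /= d_c scaler0 oppr0 add0r dconv !opprD opprK.
rewrite (tau_mc (D x)) D_eps scale0r add0r Dconv dtD S1 S2 -A3.
set a := d (d _); set b := conv m (d \o _ \o _) _ _; set e := conv m tau (d \o tau) x.
set g := conv m (conv _ _ _) _ _; set u := m c _; set v := m _ c.
rewrite opprK opprD opprK.
have -> : u + b + g - (v + e + g) = (u - v) + (b - e).
  by rewrite !opprD addrACA subrr addr0 addrACA.
by rewrite opprD [X in X + (u - v)]addrACA subrr addr0 subrK.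
Qed.
End MaurerCartan.

(** * The bar construction *)

Section TensorCocomplete.
Variables (k : comPzRingType) (V : gmod k) (D : {linear tgr V -> tgr V}).
Hypothesis D_deg : degree 1 D.
Hypothesis D_sqr : forall x, D (D x) = 0.
Hypothesis D_co : forall x,
  tdelta V (D x) = tmapl D idfun (tdelta V x) + tmapl (parity (tgr V)) D (tdelta V x).
Hypothesis D_eta : forall x, teta V (D x) = 0.
Local Notation X := (tcoalg D_deg D_sqr D_co D_eta).

(** Cutting a word into more than length-many pieces leaves an empty piece, which
is zero in the reduced coalgebra. *)
Fact red_iter_word n u : (size u <= n)%N ->
  red_comul_iter n (rpr X (word u)) = 0.
Proof.
have r1 : rpr X (word [::]) = 0.
  by rewrite -(rpr_augm X (1 : k)) /= taugE scale1r.
elim: n u => [|n IH] u un; first by case: u un => [_|//]; rewrite /= r1.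
have [d Hd] := red_comul_iter_lin X n; have [e [He Hr]] := red_comul_lin X.
rewrite [LHS]/=; have -> : @red_comul_iter k X n = d by apply: funext => z; rewrite Hd.
rewrite -He Hr tmaplE /= tdelta_word !linear_sum big_ord_recl.
rewrite /= !tmapl_tens take0 r1 tens0l add0r big1 // => i _.
rewrite !tmapl_tens Hd IH ?tens0r // size_drop /= leq_subLR.
by rewrite (leq_trans un) // addSn ltnS leq_addl.
Qed.

Lemma tcoalg_cocomplete : cocomplete X.
Proof.
move=> x; have [t ->] := rpr_surj x; rewrite [t : tensor_alg V]presented_gen.
have [|N HN] := @eventually_all _ (fun z n => red_comul_iter n (rpr X (word z.2)) = 0)
  (repr (t : tensor_alg V)); first by move=> z; exists (size z.2) => n; apply: red_iter_word.
exists N; have [d Hd] := red_comul_iter_lin X N.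
rewrite -Hd (linear_sum (rpr X)) linear_sum big_seq big1 // => z zs.
by rewrite !linearZ /= Hd -[gen _]/(word z.2) HN ?scaler0.
Qed.
End TensorCocomplete.

Section Bar.
Variables (k : comPzRingType) (A : curved_dga k).
Local Notation V := (gshift 1 A).
Local Notation T := (tensor_alg V).
Local Notation G := (tgr V).

(* The components -s m_i w^i of the bar differential. *)
Let beta0 : V := - curv A.
Let beta1 : {linear V -> V} := GRing.opp_fun (adiff A).
Let beta2 : bilmap V V V := bcomp (GRing.opp_fun idfun) (amulb A : bilmap V V V) (parity V) idfun.

Fact beta0_homog : homog 1 beta0.
Proof. exact/homogN/(@curv_homog k A). Qed.
Fact beta1_homog p (v : V) : homog p v -> homog (p + 1) (beta1 v).
Proof. by move=> vp; apply/homogN/(adiff_deg (c := A) vp). Qed.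
Fact beta2_homog p q (v w : V) : homog p v -> homog q w -> homog (p + q + 1) (beta2 v w).
Proof.
move=> vp wq; rewrite /= (parity_homog vp) bZl; apply/homogN/homogZ; rewrite -amulbE.
have := amul_homog (c := A) vp wq; rewrite /homog /=.
by have -> : p + 1 + (q + 1) = p + q + 1 + 1 by ring.
Qed.

(** Multiplies a letter with the first letter of a word. *)
Fact tmerge_sig : {b : bilmap V T T | forall v, b v tone = 0 /\
  forall w t, b v (tcons w t) = tcons (beta2 v w) t}.
Proof.
apply: cid.
have H v : exists h : {linear T -> T}, h tone = 0 /\
    forall w t, h (tcons w t) = tcons (beta2 v w) t.
  have [h [h1 hc]] := talg_rec 0 (bcomp idfun tcons (bapr beta2 v) idfun) (bzero V T T).
  by exists h; split=> // w t; rewrite hc addr0 [LHS]/= baprE.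
have [h Hh] := choice H.
have hL t : linear (h^~ t).
  move=> a v w; elim/talg_ind: t => [b x y Hx Hy||u t _].
  - by rewrite !linearP Hx Hy !scalerDr !scalerA !addrA [b * a]mulrC;
       congr (_ + _); rewrite -!addrA; congr (_ + _); rewrite addrC.
  - by rewrite !(proj1 (Hh _)) scaler0 addr0.
  by rewrite !(proj2 (Hh _)) bDl bZl bDl bZl.
have hR v : linear (h v) by move=> a x y; rewrite linearP.
by exists (Bilmap hL hR).
Qed.
Definition tmerge : bilmap V T T := sval tmerge_sig.
Lemma tmerge1 v : tmerge v tone = 0.
Proof. by have [] := svalP tmerge_sig v. Qed.
Lemma tmerge_cons v w t : tmerge v (tcons w t) = tcons (beta2 v w) t.
Proof. by have [_] := svalP tmerge_sig v. Qed.

Lemma teta_merge v t : teta V (tmerge v t) = 0.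
Proof.
elim/talg_ind: t => [a x y Hx Hy||w t _].
- by rewrite bDr bZr linearP Hx Hy scaler0 addr0.
- by rewrite tmerge1 linear0.
by rewrite tmerge_cons teta_cons.
Qed.

Lemma tletter_merge v t : tletter V (tmerge v t) = beta2 v (tletter V t).
Proof.
elim/talg_ind: t => [a x y Hx Hy||w t _].
- by rewrite bDr bZr !linearP Hx Hy bDr bZr.
- by rewrite tmerge1 linear0 tletter1 b0r.
by rewrite tmerge_cons !tletter_cons bZr.
Qed.

Lemma tdelta_merge v t : tdelta V (tmerge v t) =
  tens tone (tmerge v t) + tmapl (bapr tmerge v) idfun (tdelta V t).
Proof.
elim/talg_ind: t => [a x y Hx Hy||w t _].
- rewrite bDr bZr !linearP Hx Hy scalerDr tensDr tensZr.
  by rewrite addrACA.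
- by rewrite tmerge1 linear0 tens0r tdelta1 tmapl_tens baprE tmerge1 tens0l addr0.
rewrite tmerge_cons !tdelta_cons linearD tmapl_tens baprE tmerge1 tens0l add0r.
congr (_ + _); have [s ->] := tensor_sum (tdelta V t); rewrite !bsumr linear_sum.
by apply: eq_bigr => z _; rewrite !lact_tens tmapl_tens baprE tmerge_cons.
Qed.

Fact bdiff_sig : {h : {linear T -> T} | h tone = tcons beta0 tone /\
  forall v t, h (tcons v t) = tcons beta0 (tcons v t) + tcons (beta1 v) t + tmerge v t
    + tcons (parity V v) (h t)}.
Proof.
apply: cid; have [h [h1 hc]] := talg_rec (tcons beta0 tone)
  (badd (badd (bcomp (bapr tcons beta0) tcons idfun idfun) (bcomp idfun tcons beta1 idfun))
     tmerge) (bcomp idfun tcons (parity V) idfun).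
by exists h; split=> // v t; rewrite hc [LHS]/= baprE.
Qed.
(** The coderivation inserts the curvature before the first letter, or acts on
the first letter, or multiplies the first two letters, or leaves the first
letter in place, up to a Koszul sign, and acts on the rest. *)
Definition bdiff : {linear G -> G} := sval bdiff_sig.
Lemma bdiff1 : bdiff tone = tcons beta0 tone.
Proof. by have [] := svalP bdiff_sig. Qed.
Lemma bdiff_cons v t : bdiff (tcons v t) =
  tcons beta0 (tcons v t) + tcons (beta1 v) t + tmerge v t + tcons (parity V v) (bdiff t).
Proof. by have [_] := svalP bdiff_sig. Qed.

Fact bdiff_deg : degree 1 bdiff.
Proof.
suff H n (t : G) : homog n t -> [/\ homog n t, homog (n + 1) (bdiff t)
    & forall p v, homog p v -> homog (p + n + 1) (tmerge v t : G)].
  by move=> n t /H [].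
move: n t; apply: tgr_homog_ind.
- move=> n; rewrite linear0; split=> [||p v _]; rewrite ?b0r; exact: homog0.
- move=> n a x y [x1 x2 x3] [y1 y2 y3]; split; first exact: homogP.
    by rewrite linearP; apply: homogP.
  by move=> p v vp; rewrite bDr bZr; apply: (@homogP _ G); [exact: x3 | exact: y3].
- split; first exact: tone_homog.
    by rewrite bdiff1; apply: (tcons_homog beta0_homog (tone_homog V)).
  by move=> p v _; rewrite tmerge1; apply: (@homog0 _ G).
move=> p n v t vp [tn tD tc]; have vt := tcons_homog vp tn; split=> //.
  rewrite bdiff_cons; apply: homogD; first apply: homogD; first apply: homogD.
  - by rewrite addrC; apply: (tcons_homog beta0_homog vt).
  - by rewrite addrAC; apply: (tcons_homog (beta1_homog vp) tn).
  - exact: tc.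
  by rewrite -addrA; apply: (tcons_homog _ tD); rewrite (parity_homog vp); apply: homogZ.
move=> q w wq; rewrite tmerge_cons.
have -> : q + (p + n) + 1 = q + p + 1 + n by ring.
exact: (tcons_homog (beta2_homog wq vp) tn).
Qed.

Fact bdiff_co x :
  tdelta V (bdiff x) = tmapl bdiff idfun (tdelta V x) + tmapl (parity G) bdiff (tdelta V x).
Proof.
elim/talg_ind: x => [a x y Hx Hy||v t IH].
- by rewrite !linearP Hx Hy scalerDr /= addrACA.
- by rewrite bdiff1 tdelta_cons tdelta1 lact_tens !tmapl_tens bdiff1 parity_tone addrC.
have [s E] := tensor_sum (tdelta V t).
rewrite bdiff_cons !linearD !tdelta_cons IH tdelta_merge !linearD !tmapl_tens.
rewrite bdiff1 bdiff_cons parity_tone !tensDr.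
have -> : tmapl bdiff idfun (lact V v (tdelta V t)) =
    lact V beta0 (lact V v (tdelta V t)) + lact V (beta1 v) (tdelta V t) +
    tmapl (bapr tmerge v) idfun (tdelta V t) +
    lact V (parity V v) (tmapl bdiff idfun (tdelta V t)).
  rewrite E !(bsumr, linear_sum) -!big_split; apply: eq_bigr => z _.
  by rewrite !lact_tens !tmapl_tens !lact_tens bdiff_cons !tensDl baprE.
have -> : tmapl (parity G) bdiff (lact V v (tdelta V t)) =
    lact V (parity V v) (tmapl (parity G) bdiff (tdelta V t)).
  rewrite E !(bsumr, linear_sum); apply: eq_bigr => z _.
  by rewrite !lact_tens !tmapl_tens lact_tens parity_tcons.
by rewrite !bDr lact_tens !addrA [RHS](ACl (6*1*2*7*3*8*4*9*5*10)).
Qed.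

Fact bdiff_eta x : teta V (bdiff x) = 0.
Proof.
elim/talg_ind: x => [a x y Hx Hy||v t IH].
- by rewrite !linearP Hx Hy scaler0 addr0.
- by rewrite bdiff1 teta_cons.
by rewrite bdiff_cons !linearD /= !teta_cons teta_merge !addr0.
Qed.

Local Notation C0 := (tcoalg0 V).
Let tl : {linear C0 -> A} := tletter V.

Fact tl_deg : degree 1 tl.
Proof. by move=> p x xp; have := tletter_deg xp; rewrite addr0. Qed.

Fact tletter_bdiff_cons v t :
  tletter V (bdiff (tcons v t)) = (teta V t : k) *: beta1 v + beta2 v (tletter V t).
Proof.
rewrite bdiff_cons !linearD /= !tletter_cons tletter_merge teta_cons bdiff_eta.
by rewrite !scale0r add0r addr0.
Qed.

(* The convolution is taken in the coalgebra with zero codifferential because the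
   vanishing of the square of [bdiff] is deduced from this equation. *)
Fact bdiff_mc x : tl (bdiff x) =
  - ((eps C0 x : k) *: curv A + adiff A (tl x) + conv (amulb A) (tl \o parity C0) tl x).
Proof.
elim/talg_ind: x => [a x y Hx Hy||v t _].
- rewrite !linearP Hx Hy !scalerN !scalerDr !scalerDl !scalerA -!opprD; congr (- _).
  by rewrite !addrA [LHS](ACl (1*4*2*5*3*6)).
- rewrite bdiff1 conv_def /= tdelta1 tmapl_tens /= parity_tone /tl tletter_cons teta1 !scale1r.
  by rewrite tletter1 blift_tens b0l linear0 !addr0.
rewrite [LHS]tletter_bdiff_cons !linearD /= /tl tletter_cons teta_cons.
rewrite !scale0r oppr0 add0r; congr (_ + _).
  by rewrite linearZ /= scalerN.
rewrite conv_def /= tdelta_cons linearD tmapl_tens /= parity_tone tletter1 linearD blift_tens.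
rewrite b0l add0r.
congr (- _); have [s E] := tensor_sum (tdelta V t).
rewrite -[in LHS](proj1 (@counit_sweedler k C0 t s E)) E !(bsumr, linear_sum).
apply: eq_bigr => z _; rewrite lact_tens tmapl_tens blift_tens /= parity_tcons tletter_cons.
by rewrite linearZ bZr bZl (@eps_parity k C0 z.1 : teta V (parity G z.1) = teta V z.1).
Qed.

(** The square is a coderivation along the identity, so by rigidity only its
letter component matters, and [mc_square] computes it. *)
Fact bdiff_sqr x : bdiff (bdiff x) = 0.
Proof.
have co : @coderivation k C0 bdiff := bdiff_co.
have := @skew_comul_eq0 k V C0 (bdiff \o bdiff) idfun idfun; apply=> {}x.
- have [s E] := tensor_sum (tdelta V x); rewrite /= !bdiff_co E !linear_sum -big_split !linear_sum.
  rewrite !(@convE k C0 _ _ _ _ _ _ x s E) -!big_split; apply: eq_bigr => z _ /=.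
  rewrite !tmapl_tens /= !linearD /= !tmapl_tens /= parityK (parity_degree1 _ bdiff_deg).
  by rewrite tensNl addrA addrK.
- exact: bdiff_eta.
have := @mc_square k C0 A bdiff (adiff A) (curv A) tl co bdiff_deg bdiff_eta
  (@adiff_derivation k A) (adiff_curv A) tl_deg bdiff_mc x.
rewrite adiff_sqr !amulbE => /eqP; rewrite eq_sym -subr_eq0 addrK => /eqP; exact.
Qed.

Definition bar_obj : cga_cdg k :=
  CgaCdgObj (@tcoalg_cocomplete k V bdiff bdiff_deg bdiff_sqr bdiff_co bdiff_eta).

Fact bar_tw_augm a : (tl : {linear bar_obj -> A}) (augm bar_obj a) = 0.
Proof. by rewrite /= taugE linearZ /= /tl tletter1 scaler0. Qed.

Fact bar_tw_eq x :
  (counit bar_obj x : k) *: curv A +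
    (adiff A ((tl : {linear bar_obj -> A}) x) +
     (tl : {linear bar_obj -> A}) (codiff bar_obj x)) +
  tlift (@amul k A) (gtmap 1 (tl : {linear bar_obj -> A}) (tl : {linear bar_obj -> A})
     (comul bar_obj x)) = 0.
Proof.
rewrite gtmap_conv conv_def /= bdiff_mc conv_def.
set a := _ *: curv A; set b := adiff A _; set e := blift _ _.
by rewrite addrA [LHS]addrAC subrr.
Qed.

Definition bar_tw : Tw bar_obj A := @TwCochain k bar_obj A tl tl_deg bar_tw_augm bar_tw_eq.

Lemma teta_word (u : seq V) : teta V (word u) = (u == [::])%:R :> k.
Proof. by case: u => [|v u]; rewrite ?teta1 // -tcons_word teta_cons. Qed.

Lemma tletter_word (u : seq V) : tletter V (word u) = if u is [:: x] then x else 0.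
Proof.
case: u => [|v u]; first exact: tletter1.
rewrite -tcons_word tletter_cons teta_word; case: u => [|w u] /=; first by rewrite scale1r.
by rewrite scale0r.
Qed.

Lemma bar_tw_obj : is_bar_obj bar_tw.
Proof.
exists (idfun : {linear T -> bar_obj}); split; first by exists idfun.
move=> u; split.
- by move=> n; apply: word_homogP.
- exact: tdelta_word.
- by split; [exact: teta_word | rewrite /= taugE scale1r].
- by rewrite [LHS]tletter_word.
rewrite [LHS]/=; case: u => [|v u].
  by rewrite [LHS](congr1 tl bdiff1) [LHS]tletter_cons teta1 scale1r.
rewrite -tcons_word [LHS]tletter_bdiff_cons teta_word tletter_word; case: u => [|w [|z u]].
- by rewrite scale1r b0r addr0.
- by rewrite scale0r add0r /= parityE amulbE.
by rewrite scale0r add0r b0r.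
Qed.

(** Twisting cochains on a cocomplete coalgebra extend to coalgebra maps into
the bar construction by cofreeness; compatibility with the codifferentials and
uniqueness both follow from rigidity. *)
Lemma bar_tw_represents : tw_represents bar_tw.
Proof.
move=> C t'; pose tau : {linear C -> V} := tw_fun t'.
have tau0 a : tau (augm C a) = 0 by exact: tw_augm.
have taud : degree 0 (tau : C -> V) by move=> p x xp; rewrite addr0; apply: (tw_deg t' xp).
have [f [fdeg Hf]] := cofree_map_exists (@ga_cocomplete k C) tau0 taud.
have f_eta := teta_cofree Hf; have f_let := tletter_cofree Hf.
have f_aug := cofree_augm tau0 Hf.
have f_co := cofree_comul (@ga_cocomplete k C) tau0 Hf.
have cvb (g h : {linear C -> T}) x : tmapl g h (comul C x) = conv btens g h x.
  have [s E] := tensor_sum (comul C x); rewrite (convE _ _ _ E) E linear_sum.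
  by apply: eq_bigr => z _; rewrite tmapl_tens.
have f_parity x : parity G (f x) = f (parity C x) by exact: parity_degree0.
have f_diff x : f (codiff C x) = bdiff (f x).
  apply/eqP; rewrite -subr_eq0; apply/eqP.
  have := @skew_comul_eq0 k V C (GRing.add_fun (f \o codiff C) (GRing.opp_fun (bdiff \o f)))
    f (f \o parity C); apply=> {}x.
  - rewrite /= linearB f_co bdiff_co f_co (conv_coderivation _ _ _ _ (@codiff_coderivation k C)).
    have [s E] := tensor_sum (comul C x); rewrite !(convE _ _ _ E) !linear_sum -!big_split /=.
    rewrite -sumrB; apply: eq_bigr => z _ /=.
    rewrite !tmapl_tens /= f_parity tensDl tensDr tensNl tensNr opprD.
    by rewrite addrACA.
  - by rewrite /= linearB /= f_eta bdiff_eta subr0; apply: codiff_counit.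
  rewrite /= linearB /= f_let; apply/eqP; rewrite subr_eq0; apply/eqP.
  rewrite -[RHS]/(tl (bdiff (f x))) bdiff_mc conv_def /= f_co.
  have -> : blift (amulb A) (tmapl (tl \o parity G) tl (conv btens f f x)) =
      conv (amulb A) (t' \o parity C) t' x.
    have [s E] := tensor_sum (comul C x); rewrite !(convE _ _ _ E) !linear_sum.
    apply: eq_bigr => z _; rewrite tmapl_tens blift_tens /= f_parity.
    by congr (amulb A _ _); exact: f_let.
  have -> : tl (f x) = t' x by exact: f_let.
  have := tw_eq t' x; rewrite gtmap_conv f_eta => H.
  apply/eqP; rewrite -subr_eq0 opprK -H; apply/eqP.
  by rewrite [in RHS]addrA [RHS]addrAC [LHS]addrC.
pose F := @CoalgMor k C bar_obj f fdeg
  (fun x => etrans (f_co x) (esym (etrans (tmaplE f f _) (cvb f f x))))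
  f_eta f_aug f_diff.
exists F; split=> [x|g Hg]; first exact: f_let.
apply: coalg_mor_ext => x; apply/eqP; rewrite eq_sym -subr_eq0; apply/eqP.
pose g' : {linear C -> T} := coalg_fun g.
have g_co y : tdelta V (g' y) = conv btens g' g' y.
  by rewrite -cvb -tmaplE; exact: (coalg_mor_comul g y).
have := @skew_comul_eq0 k V C (GRing.add_fun g' (GRing.opp_fun f)) g' f; apply=> {}x.
- rewrite /= linearB g_co f_co; have [s E] := tensor_sum (comul C x).
  rewrite !(convE _ _ _ E) -sumrB -big_split; apply: eq_bigr => z _ /=.
  by rewrite tensDl tensDr tensNl tensNr addrA subrK.
- rewrite /= linearB /= f_eta; apply/eqP; rewrite subr_eq0; apply/eqP.
  exact: (coalg_mor_counit g x).
rewrite /= linearB /= f_let; apply/eqP; rewrite subr_eq0; apply/eqP.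
exact: Hg.
Qed.

End Bar.

(** * The free non-unital algebra *)

Section FreeAlgebra.
Variables (k : comPzRingType) (V : gmod k).
Local Notation R := (red_tensor_alg V).
Local Notation G := (rgr V).

Fact rmul_sig : {b : bilmap R R R | (forall v y, b (rletter v) y = rtcons v y) /\
  forall v r y, b (rtcons v r) y = rtcons v (b r y)}.
Proof.
apply: cid.
have H y : exists h : {linear R -> R}, (forall v, h (rletter v) = rtcons v y) /\
    forall v r, h (rtcons v r) = rtcons v (h r).
  have [h [h1 hc]] := ralg_rec (bapl rtcons y) (bzero V R R) rtcons.
  by exists h; split=> [v|v r]; rewrite ?h1 ?baplE // hc add0r.
have [h Hh] := choice H.
have hL y : linear (h y) by move=> a u w; rewrite linearP.
have hR x : linear (h^~ x).
  move=> a y z; elim/ralg_ind: x => [b u w Hu Hw|v|v r Hr].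
  - rewrite !linearP Hu Hw !scalerDr !scalerA [b * a]mulrC !addrA.
    by congr (_ + _); rewrite addrAC.
  - by rewrite !(proj1 (Hh _)) bDr bZr.
  by rewrite !(proj2 (Hh _)) Hr bDr bZr.
by exists (Bilmap hL hR); split=> [v y|v r y] /=; [exact: (proj1 (Hh y)) | exact: (proj2 (Hh y))].
Qed.
Definition rmul : bilmap R R R := sval rmul_sig.
Lemma rmul_letter v y : rmul (rletter v) y = rtcons v y.
Proof. by have [] := svalP rmul_sig. Qed.
Lemma rmul_cons v r y : rmul (rtcons v r) y = rtcons v (rmul r y).
Proof. by have [_] := svalP rmul_sig. Qed.

Lemma rmul_word u w : u != [::] -> w != [::] ->
  rmul (red_word u) (red_word w) = red_word (u ++ w).
Proof.
elim: u => // v [|v' u] IH _ w0; first by rewrite -rletterE rmul_letter rtcons_word.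
by rewrite -rtcons_word // rmul_cons IH // rtcons_word.
Qed.

Fact rmulA : associative rmul.
Proof.
move=> x y z; elim/ralg_ind: x => [a u w Hu Hw|v|v r Hr].
- by rewrite !(bDl, bZl) Hu Hw.
- by rewrite !rmul_letter rmul_cons.
by rewrite !rmul_cons Hr.
Qed.

Fact rmul_homog p q (x y : G) : homog p x -> homog q y -> homog (p + q) (rmul x y : G).
Proof.
move=> xp; move: q y; move: p x xp.
apply: (@rgr_homog_ind k V
  (fun p x => forall q y, @homog k G q y -> @homog k G (p + q) (rmul x y))).
- by move=> n q y _; rewrite b0l; apply: (@homog0 _ G).
- move=> n a x y Hx Hy q z zq; rewrite bDl bZl.
  by apply: (@homogP _ G); [exact: Hx | exact: Hy].
- by move=> p v vp q y yq; rewrite rmul_letter; apply: rtcons_homog.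
move=> p n v r vp Hr q y yq; rewrite rmul_cons -addrA.
exact: rtcons_homog vp (Hr _ _ yq).
Qed.

Let null : {linear G -> G} := GRing.null_fun _.
Fact rnull_deg : degree 1 null.
Proof. by move=> p x _; apply: homog0. Qed.
Fact rnull_sqr a : null (null a) = rmul 0 a - rmul a 0.
Proof. by rewrite b0l b0r subr0. Qed.
Fact rnull_mul p (a b : G) : homog p a ->
  null (rmul a b) = rmul (null a) b + (-1) ^+ absz p *: rmul a (null b).
Proof. by rewrite /null /= b0l b0r scaler0 addr0. Qed.

(* The free algebra with zero differential and curvature, for access to
   convolution. *)
Definition ralg0 : curved_dga k :=
  @CurvedDga k G rmul 0 null (bil_l rmul) (bil_r rmul) rmul_homog rmulA
    (homog0 G 2) rnull_deg erefl rnull_sqr rnull_mul.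

Lemma ralg0E x y : amulb ralg0 x y = rmul x y.
Proof. by rewrite -amulbE. Qed.

(** The Leibniz rule serves as the recursion that extends the map from letters. *)
Lemma free_derivation (del : {linear V -> R}) :
  (forall p v, homog p v -> homog (p + 1) (del v : G)) ->
  exists D : {linear G -> G}, [/\ forall v, D (rletter v) = del v,
    @derivation k ralg0 D & degree 1 D].
Proof.
move=> deld; have [D [D1 Dc]] :=
  ralg_rec del (bcomp idfun rmul del idfun) (bcomp idfun rtcons (parity V) idfun).
have Dder : @derivation k ralg0 D.
  move=> x y; rewrite !ralg0E.
  elim/ralg_ind: x => [a u w Hu Hw|v|v r Hr].
  - by rewrite !(linearP, bDl, bZl) Hu Hw scalerDr addrACA.
  - by rewrite rmul_letter Dc /= D1 parity_rletter rmul_letter.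
  rewrite rmul_cons !Dc /= Hr parity_rtcons rmul_cons bDl rmul_cons bDr.
  by rewrite addrA rmulA.
exists D; split=> // n r rn; suff [] : homog n r /\ homog (n + 1) (D r : G) by [].
move: n r rn; apply: rgr_homog_ind.
- by move=> n; rewrite linear0; split; apply: homog0.
- move=> n a x y [x1 x2] [y1 y2]; split; first exact: homogP.
  by rewrite linearP; apply: homogP.
- by move=> p v vp; rewrite D1; split; [exact: rletter_homog | exact: deld].
move=> p n v r vp [rn rD]; split; first exact: rtcons_homog.
rewrite Dc /=; apply: homogD.
  by rewrite addrAC; apply: rmul_homog (deld _ _ vp) rn.
by rewrite -addrA; apply: rtcons_homog rD; rewrite (parity_homog vp); apply: homogZ.
Qed.

End FreeAlgebra.

(** * The cobar construction *)

Section Cobar.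
Variables (k : comPzRingType) (C : cga_cdg k).
Local Notation rC := (red_coalg C).
Local Notation V := (gshift (-1) rC).
Local Notation R := (red_tensor_alg V).
Local Notation G := (rgr V).
Local Notation R0 := (ralg0 V).

Definition ctau : {linear C -> R} := rletter \o (rpr C : {linear C -> V}).
Fact ctau_deg : degree 1 (ctau : C -> G).
Proof.
move=> p x xp; apply: rletter_homog; rewrite /homog /= addrK.
by have := @rpr_deg k C _ _ xp; rewrite addr0.
Qed.
Fact ctau_augm a : ctau (augm C a) = 0.
Proof. by rewrite /= rpr_augm linear0. Qed.

(* The augmentation has counit 1 and is killed by the universal cochain, so the
   twisting cochain equation there leaves no choice for the curvature. *)
Fact ccurv_sig : {c : R | c = - ctau (codiff C (augm C (1 : k)))}.
Proof. by exists (- ctau (codiff C (augm C (1 : k)))). Qed.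
Definition ccurv : R := sval ccurv_sig.
Lemma ccurvE : ccurv = - ctau (codiff C (augm C (1 : k))).
Proof. exact: svalP ccurv_sig. Qed.

Fact augm_homog : homog 0 (augm C (1 : k)).
Proof. by rewrite -[0]addr0; apply: augm_deg. Qed.

Fact ccurv_homog : homog 2 (ccurv : G).
Proof. by rewrite ccurvE; apply: homogN; apply: ctau_deg (codiff_deg augm_homog). Qed.

Let tau2 : {linear C -> R} := conv (amulb R0) (ctau \o parity C) ctau.

Fact tau2_augm a : tau2 (augm C a) = 0.
Proof.
rewrite augm_scale linearZ /= /tau2 conv_def augm_comul tmapl_tens ctau_augm.
by rewrite blift_tens b0r scaler0.
Qed.

(* The twisting cochain equation forces this value of the differential on the
   letter of x. *)
Fact theta_sig : {t : {linear C -> R} |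
  forall x, t x = - ((eps C x : k) *: ccurv + ctau (codiff C x) + tau2 x)}.
Proof.
exists (GRing.opp_fun (GRing.add_fun (GRing.add_fun
  (bapr (bscale (eps C) idfun : bilmap R C R) ccurv) (ctau \o codiff C)) tau2)).
by move=> x; rewrite [LHS]/= baprE.
Qed.
Definition theta : {linear C -> R} := sval theta_sig.
Fact thetaE x : theta x = - ((eps C x : k) *: ccurv + ctau (codiff C x) + tau2 x).
Proof. exact: svalP theta_sig x. Qed.

Fact theta_augm a : theta (augm C a) = 0.
Proof.
rewrite augm_scale linearZ /= thetaE tau2_augm addr0 {1}/eps augm_counit scale1r.
by rewrite ccurvE addNr oppr0 scaler0.
Qed.

Fact theta_deg n x : homog n x -> homog (n + 2) (theta x : G).
Proof.
move=> xn; rewrite thetaE; apply: homogN; apply: homogD; first apply: homogD.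
- have := @counit_deg k C _ _ xn; rewrite addr0 => /gunit_homog; rewrite -/(eps C x).
  by case=> ->; [exact/homogZ/ccurv_homog | rewrite scale0r; apply: homog0].
- by have := ctau_deg (codiff_deg xn); rewrite -addrA.
have H := @conv_homog k C G G G (amulb R0) (ctau \o parity C) ctau 1 1.
apply: H xn; [|exact/parity_degreeV/ctau_deg|exact: ctau_deg].
by move=> i j y z yi zj; rewrite ralg0E; apply: rmul_homog.
Qed.

Fact cdiff_sig : {D : {linear G -> G} | [/\ forall x, D (ctau x) = theta x,
  @derivation k R0 D & degree 1 D]}.
Proof.
apply: cid; have [del Hdel] := red_lift theta_augm.
have [|D [D1 Dd Dg]] := @free_derivation k V del.
  move=> p v /rpr_homog_surj [y yp ->]; rewrite Hdel.
  by have := theta_deg yp; have -> : p + -1 + 2 = p + 1 by ring.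
by exists D; split=> // x; rewrite [LHS]D1 Hdel.
Qed.
Definition cdiff : {linear G -> G} := sval cdiff_sig.
Fact cdiff_tau x : cdiff (ctau x) = theta x.
Proof. by have [] := svalP cdiff_sig. Qed.
Fact cdiff_der : @derivation k R0 cdiff.
Proof. by have [] := svalP cdiff_sig. Qed.
Fact cdiff_deg : degree 1 cdiff.
Proof. by have [] := svalP cdiff_sig. Qed.

Fact cdiff_curv : cdiff ccurv = 0.
Proof.
rewrite ccurvE linearN [cdiff _]cdiff_tau thetaE codiff_sqr linear0 addr0.
rewrite {1}/eps codiff_counit scale0r add0r /tau2.
rewrite (conv_coderivation _ _ _ _ (@codiff_coderivation k C)) !conv_def augm_comul.
by rewrite !tmapl_tens !blift_tens /= parityK !rpr_augm linear0 b0r b0l addr0 !oppr0.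
Qed.

Fact cdiff_letter_sqr v : cdiff (cdiff (rletter v)) =
  rmul V ccurv (rletter v) - rmul V (rletter v) ccurv.
Proof.
have [x ->] := rpr_surj (v : rC); rewrite -[rletter _]/(ctau x).
rewrite -!ralg0E.
have H := @mc_square k C R0 (codiff C) cdiff ccurv ctau
  (@codiff_coderivation k C) (codiff_deg (g := C)) (codiff_counit (g := C))
  cdiff_der cdiff_curv ctau_deg.
rewrite [LHS]H ?codiff_sqr ?linear0 ?add0r // => y.
rewrite [cdiff _]cdiff_tau thetaE.
set a := _ *: _; set b := ctau _; set e := tau2 _.
by rewrite [a - _ + e]addrAC opprB [a + b + e]addrAC [a + e + b]addrC addrK.
Qed.

(** The square of an odd derivation and the commutator with the curvature are
both derivations, so it is enough to compare them on letters. *)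
Fact cdiff_sqr r : cdiff (cdiff r) = rmul V ccurv r - rmul V r ccurv.
Proof.
elim/ralg_ind: r => [a x y Hx Hy|v|v r Hr].
- rewrite !linearP Hx Hy !(bDl, bZl, bDr, bZr) scalerBr opprD.
  by rewrite addrACA.
- exact: cdiff_letter_sqr.
rewrite -rmul_letter -ralg0E cdiff_der linearD !cdiff_der Hr cdiff_letter_sqr.
rewrite (parity_degree1 _ cdiff_deg) parityK !ralg0E bNl addrA subrK.
rewrite !(bDl, bDr, bNl, bNr) !rmulA.
by rewrite addrA subrK.
Qed.

Fact cdiff_mul p (a b : G) : homog p a ->
  cdiff (rmul V a b) = rmul V (cdiff a) b + (-1) ^+ absz p *: rmul V a (cdiff b).
Proof. by move=> ap; rewrite -ralg0E cdiff_der (parity_homog ap) !ralg0E bZl. Qed.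

Definition cobar_obj : curved_dga k :=
  @CurvedDga k G (rmul V) ccurv cdiff (bil_l (rmul V)) (bil_r (rmul V))
    (@rmul_homog k V) (@rmulA k V) ccurv_homog cdiff_deg cdiff_curv cdiff_sqr cdiff_mul.

Fact cobar_tw_eq x :
  (counit C x : k) *: curv cobar_obj +
    (adiff cobar_obj ((ctau : {linear C -> cobar_obj}) x) + ctau (codiff C x)) +
  tlift (@amul k cobar_obj) (gtmap 1 (ctau : {linear C -> cobar_obj})
     (ctau : {linear C -> cobar_obj}) (comul C x)) = 0.
Proof.
rewrite gtmap_conv.
have -> : conv (amulb cobar_obj) ((ctau : {linear C -> cobar_obj}) \o parity C) ctau x = tau2 x.
  have [s E] := tensor_sum (comul C x).
  apply: etrans (convE (amulb cobar_obj) _ _ E) (etrans _ (esym (convE (amulb R0) _ _ E))).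
  by apply: eq_bigr => z _; rewrite ralg0E -amulbE.
rewrite [adiff _ _]cdiff_tau thetaE.
set a := _ *: _; set b := ctau _; set e := tau2 _.
by rewrite addrA [a - _ + b]addrAC [LHS]addrAC subrr.
Qed.

Definition cobar_tw : Tw C cobar_obj :=
  @TwCochain k C cobar_obj ctau ctau_deg ctau_augm cobar_tw_eq.

Lemma cobar_tw_obj : is_cobar_obj cobar_tw.
Proof.
exists (idfun : {linear R -> cobar_obj}); split; first by exists idfun.
- by move=> n u _; apply: red_word_homogP.
- by move=> u w u0 w0; rewrite [RHS]rmul_word.
by move=> x; rewrite rprE [RHS]/= -rletterE.
Qed.

(** Freeness extends a twisting cochain to an algebra map; it preserves the
curvature by the twisting cochain equation at the augmentation, and commutes
with the differentials because it does so on letters. *)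
Lemma cobar_tw_corepresents : tw_corepresents cobar_tw.
Proof.
move=> A t'; have [g0 Hg] := red_lift (tw_augm t'); pose g : {linear V -> A} := g0.
have [f [f1 fc]] := ralg_rec g (bzero V R A) (bcomp idfun (amulb A) g idfun).
have fcons v r : f (rtcons v r) = amulb A (g v) (f r) by rewrite fc add0r.
have fmul x y : f (rmul V x y) = amulb A (f x) (f y).
  elim/ralg_ind: x => [a x z Hx Hz|v|v r Hr].
  - by rewrite !(bDl, bZl, linearP) Hx Hz.
  - by rewrite rmul_letter fcons f1.
  by rewrite rmul_cons !fcons Hr amulbA.
have ft x : f (ctau x) = t' x by rewrite [LHS]f1 [LHS]Hg.
have gd : degree 0 (g : V -> A).
  move=> p v /rpr_homog_surj [y yp ->]; rewrite addr0 /g Hg.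
  by have := tw_deg t' yp; rewrite subrK.
have fd : degree 0 (f : G -> A).
  move=> n r; rewrite addr0; move: n r; apply: rgr_homog_ind.
  - by move=> n; rewrite linear0; apply: homog0.
  - by move=> n a x y Hx Hy; rewrite linearP; apply: homogP.
  - by move=> p v vp; rewrite f1; have := gd _ _ vp; rewrite addr0.
  move=> p n v r vp Hr; rewrite fcons -amulbE; apply: amul_homog => //.
  by have := gd _ _ vp; rewrite addr0.
have t1 : (counit C (augm C (1 : k)) : k) = 1 by exact: augm_counit.
have fcurv : f ccurv = curv A.
  rewrite ccurvE linearN ft; have := tw_eq t' (augm C (1 : k)); rewrite t1 scale1r.
  rewrite tw_augm linear0 add0r gtmap_conv conv_def augm_comul tmapl_tens tw_augm.
  by rewrite blift_tens b0r addr0 => /eqP; rewrite addr_eq0 => /eqP ->.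
have fdiff1 v : f (cdiff (rletter v)) = adiff A (f (rletter v)).
  have [x ->] := rpr_surj (v : rC); rewrite -[rletter _]/(ctau x) cdiff_tau.
  rewrite thetaE linearN [f (_ + tau2 x)]linearD [f (_ + _)]linearD [f (_ *: _)]linearZ.
  rewrite fcurv !ft; have -> : f (tau2 x) = conv (amulb A) (t' \o parity C) t' x.
    have [s E] := tensor_sum (comul C x); rewrite /tau2 !(convE _ _ _ E) linear_sum.
    by apply: eq_bigr => z _; rewrite ralg0E [LHS]fmul !ft.
  have := tw_eq t' x; rewrite gtmap_conv => H.
  apply/eqP; rewrite eq_sym -subr_eq0 opprK -H; apply/eqP.
  set a := _ *: curv A; set b := t' _; set d := adiff A _; set e := conv _ _ _ _.
  by rewrite !addrA [d + a]addrC.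
have fdiff r : f (cdiff r) = adiff A (f r).
  elim/ralg_ind: r => [a x y Hx Hy|v|v r Hr]; last first.
  - rewrite -rmul_letter -ralg0E cdiff_der !ralg0E linearD !fmul fdiff1 Hr.
    by rewrite adiff_derivation parity_rletter !f1 (parity_degree0 _ gd).
  - exact: fdiff1.
  by rewrite !linearP Hx Hy.
exists (@AlgMor k cobar_obj A f fd fcurv
  (fun x y => etrans (fmul x y) (esym (amulbE _ _))) fdiff).
split=> [x|h Hh]; first exact: ft.
apply: alg_mor_ext => r /=; pose h' : {linear R -> A} := alg_fun h.
have := @ralg_ext k V A f h'; apply=> [v|v {}r Hr].
  by have [x ->] := rpr_surj (v : rC); rewrite [LHS]ft -Hh.
rewrite -rmul_letter fmul Hr.
have -> : f (rletter v) = h' (rletter v).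
  by have [x ->] := rpr_surj (v : rC); rewrite [LHS]ft -Hh.
by rewrite -amulbE -[RHS]/(h (amul (c := cobar_obj) (rletter v) r)) alg_mor_mul.
Qed.
End Cobar.

(** * Functoriality and adjunction *)

Section TwistingCochains.
Variable k : comPzRingType.

Section Post.
Variables (C : cga_cdg k) (A A' : curved_dga k) (f : alg_mor A A') (t : Tw C A).
Fact tw_post_deg : degree 1 (f \o t).
Proof. by move=> p x /(tw_deg t) /(alg_mor_deg f); rewrite addr0. Qed.
Fact tw_post_augm a : (f \o t) (augm C a) = 0.
Proof. by rewrite /= tw_augm linear0. Qed.
Fact tw_post_eq x : (counit C x : k) *: curv A' + (adiff A' ((f \o t) x) +
  (f \o t) (codiff C x)) + tlift (@amul k A') (gtmap 1 (f \o t) (f \o t) (comul C x)) = 0.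
Proof.
have := congr1 f (tw_eq t x); rewrite linear0 => <-; rewrite !linearD linearZ /=.
rewrite alg_mor_curv alg_mor_diff; congr (_ + _).
rewrite (gtmap_conv (f \o t) (f \o t)) (gtmap_conv t t).
have [s E] := tensor_sum (comul C x); rewrite !(convE _ _ _ E) linear_sum.
by apply: eq_bigr => z _; rewrite /= -!amulbE alg_mor_mul.
Qed.
Definition tw_post : Tw C A' := @TwCochain k C A' (f \o t) tw_post_deg tw_post_augm tw_post_eq.
End Post.

Section Pre.
Variables (C C' : cga_cdg k) (A : curved_dga k) (g : coalg_mor C C') (t : Tw C' A).
Fact tw_pre_deg : degree 1 (t \o g).
Proof. by move=> p x /(coalg_mor_deg g) /(tw_deg t); rewrite addr0. Qed.
Fact tw_pre_augm a : (t \o g) (augm C a) = 0.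
Proof. by rewrite /= coalg_mor_augm tw_augm. Qed.
Fact tw_pre_eq x : (counit C x : k) *: curv A + (adiff A ((t \o g) x) +
  (t \o g) (codiff C x)) + tlift (@amul k A) (gtmap 1 (t \o g) (t \o g) (comul C x)) = 0.
Proof.
have := tw_eq t (g x); rewrite coalg_mor_counit => <- /=; rewrite coalg_mor_codiff.
congr (_ + _); rewrite (gtmap_conv (t \o g) (t \o g)) (gtmap_conv t t).
rewrite [RHS]conv_def coalg_mor_comul tmaplE.
have [s E] := tensor_sum (comul C x); rewrite !(convE _ _ _ E) E !linear_sum.
apply: eq_bigr => z _; rewrite !tmapl_tens blift_tens /=.
by rewrite (parity_degree0 _ (coalg_mor_deg g)).
Qed.
Definition tw_pre : Tw C A := @TwCochain k C A (t \o g) tw_pre_deg tw_pre_augm tw_pre_eq.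
End Pre.

Section Represented.
Variables (A : curved_dga k) (X : cga_cdg k) (t : Tw X A) (r : tw_represents t).
Definition tw_classify (C : cga_cdg k) (t' : Tw C A) : coalg_mor C X := sval (cid (r t')).
Lemma tw_classifyE (C : cga_cdg k) (t' : Tw C A) x : t (tw_classify t' x) = t' x.
Proof. by have [H _] := svalP (cid (r t')). Qed.
Lemma tw_represented_inj (C : cga_cdg k) (f g : coalg_mor C X) :
  (forall x, t (f x) = t (g x)) -> f = g.
Proof.
move=> fg; have [h [_ Hu]] := r (tw_pre g t).
by rewrite -(Hu g) // -(Hu f) // => x; apply: fg.
Qed.
End Represented.

Section Corepresented.
Variables (C : cga_cdg k) (Y : curved_dga k) (t : Tw C Y) (r : tw_corepresents t).
Definition tw_extend (A : curved_dga k) (t' : Tw C A) : alg_mor Y A := sval (cid (r t')).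
Lemma tw_extendE (A : curved_dga k) (t' : Tw C A) x : tw_extend t' (t x) = t' x.
Proof. by have [H _] := svalP (cid (r t')). Qed.
Lemma tw_corepresented_inj (A : curved_dga k) (f g : alg_mor Y A) :
  (forall x, f (t x) = g (t x)) -> f = g.
Proof.
move=> fg; have [h [_ Hu]] := r (tw_post g t).
by rewrite -(Hu g) // -(Hu f) // => x; apply: fg.
Qed.
End Corepresented.

Section BarFunctor.
Variables (X : curved_dga k -> cga_cdg k) (t : forall A, Tw (X A) A).
Hypothesis r : forall A, tw_represents (t A).
Definition rep_map (A A' : curved_dga k) (f : alg_mor A A') : coalg_mor (X A) (X A') :=
  tw_classify (@r A') (tw_post f (t A)).
Lemma rep_mapE (A A' : curved_dga k) (f : alg_mor A A') x :
  t A' (rep_map f x) = f (t A x).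
Proof. exact: tw_classifyE. Qed.
Fact rep_map_id A : rep_map (alg_id A) = coalg_id (X A).
Proof. by apply: (tw_represented_inj (@r A)) => x; rewrite rep_mapE. Qed.
Fact rep_map_cmp A B C (g : alg_mor B C) (f : alg_mor A B) :
  rep_map (alg_cmp g f) = coalg_cmp (rep_map g) (rep_map f).
Proof. by apply: (tw_represented_inj (@r C)) => x; rewrite /= !rep_mapE. Qed.
Definition rep_functor : functor (Alg02 k) (CgaCdg k) :=
  @Functor (Alg02 k) (CgaCdg k) X rep_map rep_map_id rep_map_cmp.
End BarFunctor.

Section CobarFunctor.
Variables (Y : cga_cdg k -> curved_dga k) (t : forall C, Tw C (Y C)).
Hypothesis r : forall C, tw_corepresents (t C).
Definition corep_map (C C' : cga_cdg k) (g : coalg_mor C C') : alg_mor (Y C) (Y C') :=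
  tw_extend (@r C) (tw_pre g (t C')).
Lemma corep_mapE (C C' : cga_cdg k) (g : coalg_mor C C') x :
  corep_map g (t C x) = t C' (g x).
Proof. exact: tw_extendE. Qed.
Fact corep_map_id C : corep_map (coalg_id C) = alg_id (Y C).
Proof. by apply: (tw_corepresented_inj (@r C)) => x; rewrite corep_mapE. Qed.
Fact corep_map_cmp C D E (g : coalg_mor D E) (f : coalg_mor C D) :
  corep_map (coalg_cmp g f) = alg_cmp (corep_map g) (corep_map f).
Proof. by apply: (tw_corepresented_inj (@r C)) => x; rewrite /= !corep_mapE. Qed.
Definition corep_functor : functor (CgaCdg k) (Alg02 k) :=
  @Functor (CgaCdg k) (Alg02 k) Y corep_map corep_map_id corep_map_cmp.
End CobarFunctor.

Lemma bar_cobar_adjoint (B : functor (Alg02 k) (CgaCdg k))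
    (Omega : functor (CgaCdg k) (Alg02 k)) :
  is_bar B -> is_cobar Omega -> left_adjoint Omega B.
Proof.
move=> [tB [_ rB nB]] [tO [_ rO nO]].
pose Phi (C : CgaCdg k) (A : Alg02 k) (u : Defs.hom (Omega C) A) : Defs.hom C (B A) :=
  tw_classify (@rB A) (tw_post u (tO C)).
pose Psi (C : CgaCdg k) (A : Alg02 k) (f : Defs.hom C (B A)) : Defs.hom (Omega C) A :=
  tw_extend (@rO C) (tw_pre f (tB A)).
have PhiE (C : cga_cdg k) (A : curved_dga k) (u : alg_mor (Omega C) A) (x : C) :
    tB A ((Phi C A u : coalg_mor C (B A)) x) = u (tO C x).
  exact: tw_classifyE.
have PsiE (C : cga_cdg k) (A : curved_dga k) (f : coalg_mor C (B A)) (x : C) :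
    (Psi C A f : alg_mor (Omega C) A) (tO C x) = tB A (f x).
  exact: tw_extendE.
exists Phi; split=> [C A|C C' A f u|C A A' g u].
- exists (@Psi C A) => [u|f].
    by apply: (tw_corepresented_inj (@rO C)) => x; rewrite PsiE PhiE.
  by apply: (tw_represented_inj (@rB A)) => x; rewrite PhiE PsiE.
- by apply: (tw_represented_inj (@rB A)) => x; rewrite PhiE /= nO PhiE.
by apply: (tw_represented_inj (@rB A')) => x; rewrite PhiE /= nB PhiE.
Qed.

End TwistingCochains.

Theorem mainTheorem5 (k : comPzRingType) :
  [/\ exists B : functor (Alg02 k) (CgaCdg k), is_bar B,
      exists Omega : functor (CgaCdg k) (Alg02 k), is_cobar Omega
    & forall (B : functor (Alg02 k) (CgaCdg k))
             (Omega : functor (CgaCdg k) (Alg02 k)),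
        is_bar B -> is_cobar Omega -> left_adjoint Omega B].
Proof.
split; last exact: bar_cobar_adjoint.
- exists (rep_functor (@bar_tw_represents k)), (@bar_tw k).
  split=> [A|A|A A' f x]; [exact: bar_tw_obj | exact: bar_tw_represents | ].
  exact: rep_mapE.
exists (corep_functor (@cobar_tw_corepresents k)), (@cobar_tw k).
split=> [C|C|C C' g x]; [exact: cobar_tw_obj | exact: cobar_tw_corepresents | ].
exact: corep_mapE.
Qed.
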